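(* Let $(\mathsf{Gen},\mathsf{Sign},\mathsf{Ver})$ be a one-time oracle signature scheme with perfect completeness in the random oracle model for a message space $\mathcal{M}$, in which the total number of oracle queries asked by $\mathsf{Gen}$, $\mathsf{Sign}$ and $\mathsf{Ver}$ is at most $q$. Let $\lambda,\delta>0$ and suppose $|\mathcal{M}|\ge \binom{q}{q/2}/\lambda$. Then there is a (computationally unbounded) adversary which asks at most $O\!\left(\frac{q^2\binom{q}{q/2}}{\lambda\delta^2}\right)=O\!\left(\frac{q^{1.5}2^q}{\lambda\delta^2}\right)$ oracle queries and breaks the scheme with probability $1-(\lambda+\delta)$, where this probability is over the randomness of the oracle, the coin tosses of the key generation algorithm, and the coin tosses of the adversary.
   Context: Random oracle: for each input length $\ell$, an independent uniformly random function $\{0,1\}^\ell\to\{0,1\}^\ell$, accessible only by queries. An oracle signature scheme with perfect completeness for $\mathcal{M}$ is a triple of oracle algorithms $(\mathsf{Gen},\mathsf{Sign},\mathsf{Ver})$ ($\mathsf{Gen}$ possibly probabilistic, outputting $(SK,VK)$) such that for every oracle $\mathcal{O}$, every $(SK,VK)$ output by $\mathsf{Gen}^{\mathcal{O}}$ with positive probability and every $\alpha\in\mathcal{M}$, $\mathsf{Ver}^{\mathcal{O}}(VK,\alpha,\mathsf{Sign}^{\mathcal{O}}(SK,\alpha))=1$. The total number of queries is counted over generating the keys, signing one message and verifying that signature. Breaking the (one-time) scheme: the adversary receives $VK$, chooses a message $\alpha\in\mathcal{M}$ (independently of $VK$), receives $\sigma=\mathsf{Sign}^{\mathcal{O}}(SK,\alpha)$,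 may query the oracle, and outputs $(\alpha^*,\sigma^* )$; it breaks the scheme if $\alpha^*\ne\alpha$ and $\mathsf{Ver}^{\mathcal{O}}(VK,\alpha^*,\sigma^* )=1$. Oracle queries made by the adversary include all queries it makes in any computation it performs. *)

(* Defs.v *)
From mathcomp Require Import all_boot all_order all_algebra.
From mathcomp Require Import all_classical all_reals all_analysis.

Set Implicit Arguments.
Unset Strict Implicit.
Unset Printing Implicit Defensive.
Import Order.TTheory GRing.Theory Num.Theory.
Import numFieldNormedType.Exports.

Local Open Scope classical_set_scope.
Local Open Scope ring_scope.

Definition oracle : Type := forall l : nat, l.-tuple bool -> l.-tuple bool.

(* A deterministic oracle algorithm: its tree of queries. Trees are
   well-founded, so algorithms halt on every oracle; the local computation
   between two queries is unrestricted. *)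
Inductive oalg (A : Type) : Type :=
| Return of A
| Query (l : nat) (x : l.-tuple bool) of (l.-tuple bool -> oalg A).

Fixpoint run (O : oracle) (A : Type) (p : oalg A) : A :=
  match p with
  | Return a => a
  | Query l x k => run O (k (O l x))
  end.

(* Repeated queries are counted each time they are asked. *)
Fixpoint nqueries (O : oracle) (A : Type) (p : oalg A) : nat :=
  match p with
  | Return _ => 0
  | Query l x k => (nqueries O (k (O l x))).+1
  end.

(* The randomness of a probabilistic algorithm: an arbitrary discrete
   probability distribution. A probabilistic oracle algorithm is a family of
   deterministic ones indexed by the outcome of its coins. *)
Record coins (R : realType) : Type := Coins {
  outcome : countType;
  pmf : outcome -> R;
  pmf_ge0 : forall c, 0 <= pmf c;
  pmf_sum1 : (\esum_(c in [set: outcome]) (pmf c)%:E = 1)%E }.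

Record scheme (R : realType) (M : Type) : Type := Scheme {
  skey : Type;
  vkey : Type;
  signature : Type;
  gen_coins : coins R;
  gen : outcome gen_coins -> oalg (skey * vkey);
  sign : skey -> M -> oalg signature;
  ver : vkey -> M -> signature -> oalg bool }.

Definition perfectly_complete (R : realType) (M : Type) (S : scheme R M) : Prop :=
  forall (O : oracle) (g : outcome (gen_coins S)), 0 < pmf g ->
  forall m : M,
    let: (sk, vk) := run O (gen g) in
    run O (ver vk m (run O (sign sk m))) = true.

Definition total_queries_le (R : realType) (M : Type) (S : scheme R M) (q : nat)
    : Prop :=
  forall (O : oracle) (g : outcome (gen_coins S)), 0 < pmf g ->
  forall m : M,
    let: (sk, vk) := run O (gen g) in
    (nqueries O (gen g) + nqueries O (sign sk m)
     + nqueries O (ver vk m (run O (sign sk m))) <= q)%N.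

(* The message to be signed is a function of the adversary's coins only, hence
   independent of the oracle and of the verification key. *)
Record adversary (R : realType) (M : Type) (S : scheme R M) : Type := Adversary {
  adv_coins : coins R;
  adv_msg : outcome adv_coins -> M;
  adv_forge : outcome adv_coins -> vkey S -> signature S -> oalg (M * signature S) }.

Definition adv_queries_le (R : realType) (M : Type) (S : scheme R M)
    (A : adversary S) (b : R) : Prop :=
  forall (O : oracle) (a : outcome (adv_coins A)) (vk : vkey S) (s : signature S),
    (nqueries O (adv_forge a vk s))%:R <= b.

Definition breaks (R : realType) (M : Type) (S : scheme R M) (A : adversary S)
    (O : oracle) (g : outcome (gen_coins S)) (a : outcome (adv_coins A)) : Prop :=
  let: (sk, vk) := run O (gen g) in
  let m := adv_msg a in
  let: (m', s') := run O (adv_forge a vk (run O (sign sk m))) in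
  m' <> m /\ run O (ver vk m' s') = true.

(* The functions [O w l], for l : nat, are independent and each is uniform
   among the functions from l-bit strings to l-bit strings. *)
Definition random_oracle (R : realType) (d : measure_display)
    (Omega : measurableType d) (P : probability Omega R) (O : Omega -> oracle)
    : Prop :=
  forall (L : nat) (f : oracle),
    let E := [set w | forall l, (l < L)%N -> O w l =1 f l] in
    measurable E /\
    P E = (\prod_(l < L) (#|{ffun l.-tuple bool -> l.-tuple bool}|%:R)^-1)%:E.

Section existence.
Variable R : realType.

Let F (l : nat) : finType := {ffun l.-tuple bool -> l.-tuple bool}.
Let pr (L : nat) : nat := \prod_(l < L) #|F l|.

Let F_gt0 l : (0 < #|F l|)%N.
Proof. by apply/card_gt0P; exists [ffun x => x]. Qed.

Let pr_gt0 L : (0 < pr L)%N.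
Proof. by rewrite prodn_gt0. Qed.

Let prS L : pr L.+1 = (pr L * #|F L|)%N.
Proof. by rewrite /pr big_ord_recr. Qed.

Let u (w : R) : R := if (0 <= w) && (w < 1) then w else 0.
Let N L (w : R) : nat := Num.truncn (u w * (pr L)%:R).

Let u_itv w : 0 <= u w < 1.
Proof. by rewrite /u; case: ifP => //; rewrite lexx ltr01. Qed.

Let N0 w : N 0 w = 0%N.
Proof.
rewrite /N /pr big_ord0 mulr1; apply: truncn_def.
by have := u_itv w.
Qed.

Let NP L w k : N L w = k <-> k%:R <= u w * (pr L)%:R < k.+1%:R.
Proof.
have /andP[u0 _] := u_itv w.
split=> [<-|]; last exact: truncn_def.
by apply: truncn_itv; rewrite mulr_ge0.
Qed.

Let NS L w : (N L.+1 w %/ #|F L|)%N = N L w.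
Proof.
apply/esym/NP; have /(_ erefl) := (NP L.+1 w (N L.+1 w)).1.
set n := N L.+1 w => /andP[n1 n2].
have m0 : (0 : R) < #|F L|%:R by rewrite ltr0n.
have e : u w * (pr L.+1)%:R = u w * (pr L)%:R * #|F L|%:R :> R.
  by rewrite prS natrM mulrA.
rewrite e in n1 n2.
apply/andP; split.
  rewrite -(ler_pM2r m0); apply: le_trans n1.
  by rewrite -natrM ler_nat leq_divM.
rewrite -(ltr_pM2r m0); apply: lt_le_trans n2 _.
by rewrite -natrM ler_nat ltn_ceil.
Qed.

Let digit_lt l w : (N l.+1 w %% #|F l| < #|F l|)%N.
Proof. exact: ltn_pmod. Qed.

Let Or (w : R) : oracle := fun l => enum_val (Ordinal (digit_lt l w)) : F l.

Let rk (f : oracle) l : nat := enum_rank (finfun (f l) : F l).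

Let OrP w f l : @Or w l =1 f l <-> (N l.+1 w %% #|F l|)%N = rk f l.
Proof.
rewrite /Or /rk; split=> [e|e x].
  have -> : finfun (f l) = enum_val (Ordinal (digit_lt l w)) :> F l.
    by apply/ffunP => x; rewrite ffunE e.
  by rewrite enum_valK.
have -> : Ordinal (digit_lt l w) = enum_rank (finfun (f l) : F l).
  exact/val_inj.
by rewrite enum_rankK ffunE.
Qed.

Let K (f : oracle) : nat -> nat :=
  fix K L := if L is L'.+1 then (K L' * #|F L'| + rk f L')%N else 0%N.

Let rk_lt f l : (rk f l < #|F l|)%N.
Proof. exact: ltn_ord. Qed.

Let KP f L w : (forall l, (l < L)%N -> @Or w l =1 f l) <-> N L w = K f L.
Proof.
elim: L => [|L IH]; first by rewrite N0.
split=> [h|h].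
  have hL : N L w = K f L by apply/IH => l lL; apply: h; rewrite ltnW.
  by rewrite (divn_eq (N L.+1 w) #|F L|) NS hL (OrP w f L).1//; exact: h.
have h1 : N L w = K f L.
  by rewrite -NS h /= divnMDl// (divn_small (rk_lt f L)) addn0.
have h2 : (N L.+1 w %% #|F L|)%N = rk f L.
  by rewrite h /= modnMDl modn_small.
move=> l; rewrite ltnS leq_eqVlt => /predU1P[->|lL]; first exact/OrP.
by move: l lL; apply/IH.
Qed.

Let K_lt f L : (K f L < pr L)%N.
Proof.
elim: L => [|L IH] /=; first by rewrite /pr big_ord0.
rewrite prS; apply: (@leq_trans (K f L * #|F L| + #|F L|)).
  by rewrite ltn_add2l.
by rewrite addnC -mulSn leq_mul2r IH orbT.
Qed.

Let measurable_u : measurable_fun setT u.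
Proof.
rewrite /u; apply: measurable_fun_if => //=.
by apply: measurable_and => //; [exact: measurable_realfun.measurable_fun_ler|
  exact: measurable_realfun.measurable_fun_ltr].
Qed.

(* Lebesgue measure on the unit interval carries a random oracle: the mixed
   radix digits of w are independent and uniform, and the digit of rank l
   selects the l-th function. *)
Lemma random_oracle_exists :
  exists (d : measure_display) (Omega : measurableType d)
    (P : probability Omega R) (O : Omega -> oracle), random_oracle P O.
Proof.
exists _, (measurableTypeR R), (uniform_prob (@ltr01 R)), Or => L f E.
set a := (K f L)%:R / (pr L)%:R : R.
set b := (K f L).+1%:R / (pr L)%:R : R.
have p0 : (0 : R) < (pr L)%:R by rewrite ltr0n.
have EE : E = u @^-1` `[a, b[.
  apply/seteqP; split => w; rewrite /E /= in_itv /= /a /b.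
    move=> /KP /NP /andP[h1 h2].
    by rewrite ler_pdivrMr// ltr_pdivlMr// h1.
  rewrite ler_pdivrMr// ltr_pdivlMr// => h.
  by apply/KP/NP.
have mE : measurable E.
  by rewrite EE -[X in measurable X]setTI; apply: measurable_u.
split => //.
have a0 : 0 <= a by rewrite divr_ge0.
have b1 : b <= 1 by rewrite ler_pdivrMr// mul1r ler_nat.
have ab : a < b by rewrite ltr_pM2r ?invr_gt0// ltr_nat.
have -> : (\prod_(l < L) (#|F l|%:R)^-1)%R = b - a.
  rewrite prodfV -natr_prod -mulrBl.
  by rewrite -natr1 [_ + 1]addrC addrK mul1r.
rewrite /= /uniform_prob integral_uniform_pdf.
have mE1 : measurable (E `&` `[0 : R, 1]) by exact: measurableI.
rewrite (eq_integral (cst 1%E)); last first.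
  move=> x; rewrite inE /= in_itv /= => -[_ x01].
  by rewrite /uniform_pdf x01 subr0 invr1.
rewrite integral_cst// mul1e.
have Iab : lebesgue_measure (`[a, b[ : set R) = (b - a)%:E.
  by rewrite lebesgue_measure_itv /= lte_fin ab -EFinB.
apply/eqP; rewrite eq_le; apply/andP; split.
  apply: (@le_trans _ _ (lebesgue_measure (`[a, b[ `|` [set (1 : R)]))).
    apply: le_measure; rewrite ?inE//; first exact: measurableU.
    move=> w [Ew /=]; rewrite in_itv /= => /andP[w0].
    rewrite le_eqVlt => /predU1P[->|w1]; first by right.
    by left; move: Ew; rewrite EE /= /u w0 w1.
  rewrite -[leRHS]adde0 -(lebesgue_measure_set1 (1 : R)) -Iab.
  exact: measureU2.
rewrite -Iab; apply: le_measure; rewrite ?inE// => w /=.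
rewrite in_itv /= => /andP[aw wb].
have w0 : 0 <= w by exact: le_trans aw.
have w1 : w < 1 by exact: lt_le_trans b1.
split; last by rewrite in_itv /= w0 ltW.
by rewrite EE /= /u w0 w1 /= in_itv /= aw.
Qed.

End existence.

(* The coins of key generation, those of the adversary and the oracle are
   mutually independent. *)
Definition success_prob (R : realType) (M : Type) (S : scheme R M)
    (A : adversary S) (d : measure_display) (Omega : measurableType d)
    (P : probability Omega R) (O : Omega -> oracle) : \bar R :=
  (\esum_(c in [set: outcome (gen_coins S) * outcome (adv_coins A)])
     (pmf c.1 * pmf c.2)%:E * P [set w | breaks (O w) c.1 c.2])%E.

Definition card_ge (R : realType) (M : Type) (r : R) : Prop :=
  exists2 n : nat, r <= n%:R & (`I_n #<= [set: M])%card.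

(* Main.v *)
Require Import Defs.
From mathcomp Require Import all_boot all_order all_algebra.
From mathcomp Require Import all_classical all_reals all_analysis.
From mathcomp Require Import ring lra zify.
Import Order.TTheory GRing.Theory Num.Theory.
Local Open Scope ring_scope.

Set Implicit Arguments.
Unset Strict Implicit.
Unset Printing Implicit Defensive.

(* On receiving a signature of one message alpha, the adversary repeatedly asks
   every point which, given its view, is likely to be queried somewhere in key
   generation or in the honest signing and verification of some message. A point
   asked in this way is relevant with probability at least eps, and at most q |M|
   points are relevant, so this stops early. The adversary then imagines a world
   (oracle and key generation coins) consistent with its view, patches the real
   oracle with the imagined one on the queries of Gen and Sign(alpha), and signs
   the other messages in the hybrid world. Exchanging the answers of the real
   and the imagined oracle outside these queries is an involution preserving the
   distribution, so up to the small probability of hitting an unlikely point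
   the hybrid is distributed like an honest world. The forgery on beta is
   accepted by the real oracle as soon as Ver(beta) meets Gen and Sign(alpha)
   only inside Ver(alpha), where the two oracles agree. The messages alpha for
   which no such beta exists form, with A = (Gen + Sign(alpha)) \ Ver(alpha) and
   B = Ver(alpha), a cross-intersecting family of set pairs, so by Bollobas'
   inequality there are at most 'C(q, q/2) of them.

   Everything is finite once the coins of Gen are cut down to a finite set of
   mass 1 - delta/4, since query trees are finitely branching; by averaging, the
   random choices of the adversary (alpha and the imagined world) can be fixed,
   so the adversary needs no coins. *)

(** * Central binomial coefficients *)

Lemma leq_bin_half (n i j : nat) :
  (i <= j)%N -> (j <= n %/ 2)%N -> ('C(n, i) <= 'C(n, j))%N.
Proof.
elim: j => [|j IH]; first by rewrite leqn0 => /eqP ->.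
rewrite leq_eqVlt => /predU1P[-> //|]; rewrite ltnS => ij jn.
apply: leq_trans (IH ij (ltnW jn)) _.
rewrite -(leq_pmul2l (ltn0Sn j)) mul_bin_left leq_mul2r.
by apply/orP; right; lia.
Qed.

Lemma leq_bin_central (n k : nat) : ('C(n, k) <= 'C(n, n %/ 2))%N.
Proof.
have [kn|nk] := leqP k (n %/ 2); first exact: leq_bin_half.
have [kn|nk'] := leqP k n; last by rewrite bin_small.
by rewrite -bin_sub//; apply: leq_bin_half => //; lia.
Qed.

Lemma leq_central_bin (m n : nat) :
  (m <= n)%N -> ('C(m, m %/ 2) <= 'C(n, n %/ 2))%N.
Proof.
by move=> mn; apply: leq_trans (leq_bin2l _ mn) (leq_bin_central _ _).
Qed.

Lemma central_bin_gt0 (n : nat) : (0 < 'C(n, n %/ 2))%N.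
Proof. by rewrite bin_gt0 leq_div. Qed.

Lemma mul_central_bin_doubleS (j : nat) :
  (j.+1 * 'C(j.+1.*2, j.+1) = j.*2.+1.*2 * 'C(j.*2, j))%N.
Proof.
have diag := mul_bin_diag j.*2.+2 j; have down := mul_bin_down j.*2.+1 j.
rewrite (_ : j.*2.+1 - j = j.+1)%N /= in down; last by lia.
by rewrite doubleS -diag /= (_ : j.*2.+2 = 2 * j.+1)%N; lia.
Qed.

Lemma central_bin_double_sqr_le (j : nat) :
  ('C(j.*2, j) ^ 2 * j.*2.+1 <= 16 ^ j)%N.
Proof.
elim: j => [//|j IH].
rewrite -(@leq_pmul2l (j.+1 ^ 2)) ?expn_gt0// mulnA -expnMn.
rewrite mul_central_bin_doubleS expnMn (expnS 16) mulnAC.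
have growth : (j.*2.+1.*2 ^ 2 * j.+1.*2.+1 <= 16 * j.+1 ^ 2 * j.*2.+1)%N.
  by rewrite doubleS; nia.
apply: leq_trans (leq_mul growth (leqnn _)) _.
by rewrite mulnCA mulnA -mulnA leq_mul2l [X in (X <= _)%N]mulnC IH orbT.
Qed.

Lemma central_bin_sqr_le (n : nat) : ('C(n, n %/ 2) ^ 2 * n <= 4 ^ n)%N.
Proof.
rewrite divn2 -{1 3 4}(odd_double_half n); move: n./2 => j.
have pow4 : (4 ^ j.*2 = 16 ^ j)%N by rewrite -mul2n expnM.
case: (odd n) => /=; last first.
  rewrite add0n pow4; apply: leq_trans (central_bin_double_sqr_le j).
  by rewrite leq_mul2l leqnSn orbT.
rewrite add1n (expnS 4) pow4.
have pascal : ('C(j.*2.+1, j) <= 2 * 'C(j.*2, j))%N.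
  case: (j) => [//|i]; have := leq_bin_central i.+1.*2 i.
  by rewrite binS divn2 doubleK; lia.
apply: (@leq_trans ((2 * 'C(j.*2, j)) ^ 2 * j.*2.+1)%N).
  by rewrite leq_mul2r leq_sqr pascal orbT.
by rewrite expnMn -mulnA leq_mul2l central_bin_double_sqr_le.
Qed.

Lemma sqr_central_bin_le_powR (R : realType) (q : nat) :
  q%:R ^+ 2 * 'C(q, q %/ 2)%:R <= q%:R `^ (3 / 2) * 2 ^+ q :> R.
Proof.
have [->|q_gt0] := posnP q.
  by rewrite expr0n /= mul0r mulr_ge0 ?powR_ge0 ?exprn_ge0.
have qR_gt0 : 0 < q%:R :> R by rewrite ltr0n.
have -> : q%:R `^ (3 / 2) = q%:R * Num.sqrt q%:R :> R.
  rewrite (_ : 3 / 2 = 1 + 2^-1); last by field.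
  by rewrite powRD ?powRr1 ?powR12_sqrt// (gt_eqF qR_gt0) implybT.
have sqrtq : Num.sqrt q%:R ^+ 2 = q%:R :> R by rewrite sqr_sqrtr// ltW.
rewrite expr2 -!mulrA ler_pM2l// -{1}sqrtq expr2 -mulrA ler_pM2l ?sqrtr_gt0//.
rewrite -(@ler_pXn2r _ 2) ?nnegrE ?mulr_ge0 ?exprn_ge0 ?sqrtr_ge0//.
rewrite exprMn sqrtq mulrC -exprM mulnC exprM -!natrX -natrM ler_nat.
exact: central_bin_sqr_le.
Qed.

(** * Bollobas' set pairs inequality *)

Section set_pairs.
Variables (R : numFieldType) (I T : finType).
Implicit Types (P : pred I) (A B : I -> {set T}) (X : {set T}).

Definition cross_intersecting P A B : Prop :=
  (forall i, P i -> [disjoint A i & B i]) /\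
  (forall i j, P i -> P j -> i != j -> ~~ [disjoint A i & B j]).

Lemma cross_intersectingD1 P A B x : cross_intersecting P A B ->
  cross_intersecting [pred i | P i && (x \notin A i)] A (fun i => B i :\ x).
Proof.
move=> [dis cross]; split=> [i /andP[Pi _]|i j /andP[Pi xA] /andP[Pj _] ij].
  exact: disjointWr (finset.subD1set _ _) (dis _ Pi).
apply: contra (cross _ _ Pi Pj ij).
rewrite !disjoint_subset => /fintype.subsetP AB; apply/fintype.subsetP => y yA.
by have := AB _ yA; rewrite !inE negb_and negbK => /predU1P[yx|//]; rewrite -yx yA in xA.
Qed.

Lemma cross_intersecting_set0 P A B i j : cross_intersecting P A B ->
  P i -> P j -> B j = finset.set0 -> i = j.
Proof.
move=> [_ cross] Pi Pj Bj; apply/eqP; apply: contraT => ij.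
by have := cross _ _ Pi Pj ij; rewrite Bj -finset.setI_eq0 finset.setI0 eqxx.
Qed.

Definition set_pair_weight (a b : nat) : R := ('C(a + b, a)%:R)^-1.

Lemma set_pair_weight_rec (n a b : nat) : (a + b <= n)%N -> (0 < b)%N ->
  (n - (a + b))%:R * set_pair_weight a b + b%:R * set_pair_weight a b.-1
  = n%:R * set_pair_weight a b.
Proof.
move=> abn b_gt0; rewrite /set_pair_weight natrB// mulrBl.
suff -> : b%:R / 'C(a + b.-1, a)%:R = (a + b)%:R / 'C(a + b, a)%:R :> R.
  by rewrite subrK.
apply/eqP; rewrite eqr_div ?pnatr_eq0 -?lt0n ?bin_gt0 ?leq_addr// -!natrM.
have := mul_bin_down (a + b) a; rewrite addKn => <-.
by rewrite (_ : (a + b).-1 = a + b.-1)%N//; lia.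
Qed.

Lemma sum_set_pair_weightD1 X (A B : {set T}) :
  A \subset X -> B \subset X -> [disjoint A & B] -> (0 < #|B|)%N ->
  \sum_(x in X | x \notin A) set_pair_weight #|A| #|B :\ x|
  = #|X|%:R * set_pair_weight #|A| #|B|.
Proof.
move=> AX BX disAB B_gt0; have cardAB : #|A :|: B| = (#|A| + #|B|)%N.
  by apply/eqP; rewrite (leq_card_setU A B).2.
have ABX : A :|: B \subset X by rewrite finset.subUset AX.
rewrite -(set_pair_weight_rec _ B_gt0) -cardAB ?subset_leq_card//.
rewrite (bigID (mem B)) /= addrC; congr (_ + _).
  rewrite -[in RHS](finset.setIidPr ABX) -cardsD.
  rewrite (eq_bigl (mem (X :\: (A :|: B)))) => [|x]; last first.
    by rewrite !inE negb_or -andbA andbC.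
  rewrite (eq_bigr (fun=> set_pair_weight #|A| #|B|)).
    by rewrite sumr_const mulr_natl.
  move=> x; rewrite !inE negb_or => /andP[/andP[_ xB] _].
  by rewrite (finset.setDidPl _)// disjoint_sym disjoints1.
rewrite (eq_bigl [in B]) => [|x /=]; last first.
  have [xB|] := boolP (x \in B); last by rewrite andbF.
  by rewrite (fintype.subsetP BX _ xB) (disjointFl disAB xB).
rewrite (eq_bigr (fun=> set_pair_weight #|A| #|B|.-1)).
  by rewrite sumr_const mulr_natl.
by move=> x xB; rewrite (cardsD1 x B) [x \in B]xB.
Qed.

(* Averaging over the elements x of the ground set: keep the pairs with x not
   in A i and delete x from their B i. *)
Lemma bollobas_sum_subset P A B X : cross_intersecting P A B ->
  (forall i, P i -> (A i \subset X) && (B i \subset X)) ->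
  \sum_(i | P i) set_pair_weight #|A i| #|B i| <= 1.
Proof.
elim: {X}_.+1 {-2}X (ltnSn #|X|) P B => // n IH X card_X P B cross sub_X.
have [/existsP[j /andP[Pj /eqP Bj_eq0]]|/existsPn B_neq0] :=
    boolP [exists j, P j && (B j == finset.set0)].
  rewrite (big_pred1 j) => [|i].
    by rewrite /set_pair_weight Bj_eq0 cards0 addn0 binn invr1.
  apply/idP/eqP => [Pi|-> //]; exact: cross_intersecting_set0 cross Pi Pj Bj_eq0.
have [X_eq0|X_gt0] := posnP #|X|.
  rewrite big1 ?ler01// => i Pi; have /andP[_ BX] := sub_X _ Pi.
  have := B_neq0 i; rewrite Pi -finset.subset0.
  by rewrite -(finset.cards0_eq X_eq0) BX.
rewrite -(@ler_pM2l _ #|X|%:R) ?ltr0n// mulr1 mulr_sumr.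
rewrite (eq_bigr (fun i => \sum_(x in X | x \notin A i)
    set_pair_weight #|A i| #|B i :\ x|)) => [|i Pi]; last first.
  have /andP[AX BX] := sub_X _ Pi; have := B_neq0 i; rewrite Pi -card_gt0 => Bi_gt0.
  by rewrite sum_set_pair_weightD1//; exact: cross.1.
rewrite (exchange_big_dep (mem X)) /=; last by move=> i x _ /andP[].
rewrite -sumr_const ler_sum// => x xX.
under eq_bigl do rewrite xX /=.
apply: (IH (X :\ x)) (cross_intersectingD1 x cross) _.
  by move: card_X; rewrite (cardsD1 x X) xX.
move=> i /andP[/sub_X/andP[AX BX] xA].
by rewrite finset.subsetD1 AX xA finset.setSD.
Qed.

Lemma bollobas_sum P A B : cross_intersecting P A B ->
  \sum_(i | P i) set_pair_weight #|A i| #|B i| <= 1.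
Proof.
move=> cross; apply: (bollobas_sum_subset (X := finset.setT) cross) => i _.
by rewrite !finset.subsetT.
Qed.

End set_pairs.

Lemma bollobas_card (I T : finType) (P : pred I) (A B : I -> {set T}) (q : nat) :
  cross_intersecting P A B -> (forall i, P i -> #|A i| + #|B i| <= q)%N ->
  (#|P| <= 'C(q, q %/ 2))%N.
Proof.
move=> cross size_le; have := bollobas_sum rat cross.
have central_gt0 : 0 < 'C(q, q %/ 2)%:R :> rat by rewrite ltr0n central_bin_gt0.
rewrite -(ler_nat rat) => sum_le1; rewrite -[leRHS]mulr1 -ler_pdivrMl//.
apply: le_trans sum_le1; rewrite -sum1_card natr_sum mulr_sumr.
apply: ler_sum => i Pi; rewrite mulr1 /set_pair_weight.
rewrite lef_pV2 ?posrE ?ltr0n ?central_bin_gt0 ?bin_gt0 ?leq_addr// ler_nat.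
exact: leq_trans (leq_bin_central _ _) (leq_central_bin (size_le _ Pi)).
Qed.

(** * Query traces of oracle algorithms *)

Definition query : countType := {l : nat & l.-tuple bool}.

Definition answer (O : oracle) (x : query) : (tag x).-tuple bool := O _ (tagged x).

Definition agree (pT : predType query) (D : pT) (O1 O2 : oracle) : Prop :=
  {in D, forall x, answer O1 x = answer O2 x}.

Definition below (L : nat) : {pred query} := [pred x | tag x < L]%N.

Definition patch_oracle (pT : predType query) (T : pT) (O1 O : oracle) : oracle :=
  fun l x => if Tagged _ x \in T then O1 l x else O l x.

Lemma answer_patch (pT : predType query) (T : pT) (O1 O : oracle) x :
  answer (patch_oracle T O1 O) x = if x \in T then answer O1 x else answer O x.
Proof. by case: x. Qed.

Lemma agree_patch (pT : predType query) (T : pT) (O1 O : oracle) :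
  agree T O1 (patch_oracle T O1 O).
Proof. by move=> x xT; rewrite answer_patch xT. Qed.

Fixpoint trace (O : oracle) (A : Type) (p : oalg A) : seq query :=
  match p with
  | Return _ => [::]
  | Query l x k => Tagged _ x :: trace O (k (O l x))
  end.

Fixpoint oalg_bind (A B : Type) (p : oalg A) (f : A -> oalg B) : oalg B :=
  match p with
  | Return a => f a
  | Query l x k => Query x (fun y => oalg_bind (k y) f)
  end.

Fixpoint logged (A : Type) (p : oalg A) : oalg (A * seq query) :=
  match p with
  | Return a => Return (a, [::])
  | Query l x k => Query x (fun y =>
      oalg_bind (logged (k y)) (fun r => Return (r.1, (Tagged _ x : query) :: r.2)))
  end.

Fixpoint patched (pT : predType query) (T : pT) (O1 : oracle) (A : Type) (p : oalg A)
    : oalg A :=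
  match p with
  | Return a => Return a
  | Query l x k =>
    if Tagged _ x \in T then patched T O1 (k (O1 l x))
    else Query x (fun y => patched T O1 (k y))
  end.

Fixpoint ofind (I A : Type) (p : I -> oalg A) (ok : I -> A -> bool) (s : seq I)
    : oalg (option (I * A)) :=
  if s is i :: s' then
    oalg_bind (p i) (fun a => if ok i a then Return (Some (i, a)) else ofind p ok s')
  else Return None.

Section traces.
Variables (A B : Type).
Implicit Types (p : oalg A) (O : oracle).

Lemma nqueries_trace O p : nqueries O p = size (trace O p).
Proof. by elim: p => //= l x k IH; rewrite IH. Qed.

Lemma agree_run O O' p : agree (trace O p) O O' ->
  run O' p = run O p /\ trace O' p = trace O p.
Proof.
elim: p => //= l x k IH OO'.
rewrite -(OO' _ (mem_head _ _) : O l x = O' l x).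
have [|-> -> //] := IH (O l x).
by apply: sub_in1 OO' => y yk; rewrite in_cons yk orbT.
Qed.

Lemma run_bind O p (f : A -> oalg B) : run O (oalg_bind p f) = run O (f (run O p)).
Proof. by elim: p => //= l x k IH; rewrite IH. Qed.

Lemma trace_bind O p (f : A -> oalg B) :
  trace O (oalg_bind p f) = trace O p ++ trace O (f (run O p)).
Proof. by elim: p => //= l x k IH; rewrite IH. Qed.

Lemma run_patched (pT : predType query) (T : pT) O1 O p :
  run O (patched T O1 p) = run (patch_oracle T O1 O) p.
Proof.
by elim: p => //= l x k IH; rewrite /patch_oracle; case: ifP => /= _; rewrite IH.
Qed.

Lemma nqueries_patched (pT : predType query) (T : pT) O1 O p :
  (nqueries O (patched T O1 p) <= nqueries (patch_oracle T O1 O) p)%N.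
Proof.
elim: p => //= l x k IH; rewrite {2}/patch_oracle; case: ifP => /= _; last exact: IH.
exact: leqW.
Qed.

Lemma trace_first_outside (pT : predType query) (K : pT) O p :
  {subset trace O p <= K} \/
  exists2 x, x \notin K & forall O', agree K O O' -> x \in trace O' p.
Proof.
elim: p => [a|l x k IH] /=; first by left.
have [xK|xK] := boolP (Tagged _ x \in K); last first.
  by right; exists (Tagged _ x) => // O' _; rewrite mem_head.
case: (IH (O l x)) => [sub|[y yK first_y]].
  by left=> y; rewrite in_cons => /predU1P[->|/sub].
right; exists y => // O' OO'.
by rewrite in_cons -(OO' _ xK : O l x = O' l x) first_y ?orbT.
Qed.

Lemma trace_bounded p : exists L, forall O, {subset trace O p <= below L}.
Proof.
elim: p => [a|l x k /choice[f IH]]; first by exists 0%N.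
exists (maxn l.+1 (\max_y f y)) => O y; rewrite in_cons => /predU1P[->|].
  by rewrite inE leq_max leqnn.
move=> /IH yf; rewrite inE leq_max; apply/orP; right.
exact: leq_trans yf (leq_bigmax _).
Qed.

End traces.

Lemma run_logged (A : Type) O (p : oalg A) :
  run O (logged p) = (run O p, trace O p).
Proof. by elim: p => //= l x k IH; rewrite run_bind IH. Qed.

Lemma trace_logged (A : Type) O (p : oalg A) : trace O (logged p) = trace O p.
Proof. by elim: p => //= l x k IH; rewrite trace_bind IH /= cats0. Qed.

Section ofind_theory.
Variables (I A : Type) (p : I -> oalg A) (ok : I -> A -> bool) (O : oracle).

Lemma run_ofind s : has (fun i => ok i (run O (p i))) s ->
  exists i, ok i (run O (p i)) /\ run O (ofind p ok s) = Some (i, run O (p i)).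
Proof.
elim: s => //= i s IH; rewrite run_bind.
by case: ifP => [oki _|_ /IH //]; exists i.
Qed.

Lemma nqueries_ofind (c : nat) s : (forall i, nqueries O (p i) <= c)%N ->
  (nqueries O (ofind p ok s) <= c * size s)%N.
Proof.
move=> pc; elim: s => [|i s IH] /=; first by rewrite muln0.
rewrite nqueries_trace trace_bind size_cat -!nqueries_trace mulnS leq_add//.
by case: ifP.
Qed.

End ofind_theory.

(** * Finite oracles *)

Definition finite_oracle (L : nat) : finType :=
  {dffun forall l : 'I_L, {ffun l.-tuple bool -> l.-tuple bool}}.

Definition extend (L : nat) (a : finite_oracle L) : oracle :=
  fun l => match @idP (l < L)%N with
           | ReflectT h => a (Ordinal h)
           | ReflectF _ => fun x => x
           end.

Definition truncate (L : nat) (O : oracle) : finite_oracle L :=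
  [ffun l : 'I_L => finfun (O l)].

Section finite_oracle_theory.
Variable L : nat.
Implicit Types (a b : finite_oracle L) (O : oracle).

Lemma card_finite_oracle_gt0 : (0 < #|finite_oracle L|)%N.
Proof. by apply/card_gt0P; exists (truncate L (fun l x => x)); rewrite inE. Qed.

Lemma extend_truncate O : agree (below L) (extend (truncate L O)) O.
Proof.
move=> [l x]; rewrite inE /= /answer /extend => lL /=.
by case: {-}_ / idP => // h; rewrite !ffunE.
Qed.

Lemma answer_extend_out a x : x \notin below L -> answer (extend a) x = tagged x.
Proof.
by rewrite inE => /negP xL; rewrite /answer /extend; case: {-}_ / idP.
Qed.

Lemma truncate_agree O O' : agree (below L) O O' -> truncate L O = truncate L O'.
Proof.
move=> OO'; apply/ffunP => l; rewrite !ffunE; apply/ffunP => x.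
by rewrite !ffunE; exact: (OO' (Tagged (fun l => l.-tuple bool) x) (ltn_ord l)).
Qed.

Lemma extendK : cancel (@extend L) (truncate L).
Proof.
move=> a; apply/ffunP => -[l lL]; rewrite ffunE; apply/ffunP => x.
rewrite ffunE /extend /=.
by case: {-}_ / idP => // h; rewrite (bool_irrelevance h lL).
Qed.

Lemma extend_inj a b : (forall x, answer (extend a) x = answer (extend b) x) -> a = b.
Proof.
by move=> ab; rewrite -[a]extendK -[b]extendK; apply: truncate_agree => x _.
Qed.

Definition mix (pT : predType query) (T : pT) a b : finite_oracle L :=
  truncate L (patch_oracle T (extend a) (extend b)).

Lemma answer_mix (pT : predType query) (T : pT) a b x :
  answer (extend (mix T a b)) x =
  if x \in T then answer (extend a) x else answer (extend b) x.
Proof.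
have [xL|xL] := boolP (x \in below L); last by rewrite !answer_extend_out// if_same.
by rewrite extend_truncate// answer_patch.
Qed.

End finite_oracle_theory.

(** * Weighted sums over finite types *)

Lemma ler_sum_fibers (R : numDomainType) (T : finType) (U : eqType) (f : T -> U)
    (W : pred T) (F G : T -> R) :
  (forall w0, W w0 -> \sum_(w | W w && (f w == f w0)) F w <=
    \sum_(w | W w && (f w == f w0)) G w) ->
  \sum_(w | W w) F w <= \sum_(w | W w) G w.
Proof.
move=> fibers; pose rep w := odflt w [pick w' | W w' && (f w' == f w)].
have repP w : W w -> W (rep w) && (f (rep w) == f w).
  by rewrite /rep; case: pickP => [//|/(_ w)]; rewrite eqxx andbT => ->.
have rep_eq w w' : W w' -> (rep w == rep w') = (f w == f w').
  move=> Ww'; apply/eqP/eqP => [rep_ww'|f_ww'].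
    have /andP[_ /eqP <-] := repP _ Ww'; rewrite -rep_ww' /rep.
    by case: pickP => [? /andP[_ /eqP]|].
  by rewrite /rep f_ww'; case: pickP => // /(_ w'); rewrite Ww' eqxx.
rewrite (partition_big rep xpredT)// [leRHS](partition_big rep xpredT)//=.
apply: ler_sum => r _.
have [/existsP[w0 /andP[Ww0 /eqP <-]]|/existsPn none] :=
    boolP [exists w, W w && (rep w == r)]; last first.
  by rewrite !big_pred0// => w; apply/negbTE/none.
under eq_bigl do rewrite rep_eq//.
by under [leRHS]eq_bigl do rewrite rep_eq//; exact: fibers.
Qed.

Definition wsum (R : numDomainType) (T : finType) (mu : T -> R) (W : pred T)
    (F : T -> R) : R :=
  \sum_(w | W w) mu w * F w.

Section weighted_sums.
Variables (R : numDomainType) (T : finType) (mu : T -> R).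
Implicit Types (W : pred T) (F G : T -> R) (c : R).

Lemma wsumD W F G : wsum mu W (fun w => F w + G w) = wsum mu W F + wsum mu W G.
Proof. by rewrite /wsum -big_split; apply: eq_bigr => w _; rewrite mulrDr. Qed.

Lemma wsumB W F G : wsum mu W (fun w => F w - G w) = wsum mu W F - wsum mu W G.
Proof. by rewrite /wsum -sumrB; apply: eq_bigr => w _; rewrite mulrBr. Qed.

Lemma mulr_wsumr W F c : c * wsum mu W F = wsum mu W (fun w => c * F w).
Proof. by rewrite /wsum mulr_sumr; apply: eq_bigr => w _; rewrite mulrCA. Qed.

Lemma wsum_cst W c : wsum mu W (fun=> c) = c * wsum mu W (fun=> 1).
Proof. by rewrite mulr_wsumr; apply: eq_bigr => w _; rewrite mulr1. Qed.

Lemma wsum_negb W (b : pred T) : wsum mu W (fun w => (~~ b w)%:R) =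
  wsum mu W (fun=> 1) - wsum mu W (fun w => (b w)%:R).
Proof.
by rewrite -wsumB; apply: eq_bigr => w _; case: (b w); rewrite ?subrr ?subr0.
Qed.

Lemma wsum_sum (I : Type) (r : seq I) (P : pred I) W (F : I -> T -> R) :
  wsum mu W (fun w => \sum_(i <- r | P i) F i w) =
  \sum_(i <- r | P i) wsum mu W (F i).
Proof.
by rewrite /wsum exchange_big; apply: eq_bigr => w _; rewrite mulr_sumr.
Qed.

Lemma wsum_exchange W (F : T -> T -> R) :
  wsum mu W (fun w => wsum mu W (F w)) =
  wsum mu W (fun w' => wsum mu W (fun w => F w w')).
Proof.
rewrite /wsum; under eq_bigr do rewrite mulr_sumr.
rewrite exchange_big; apply: eq_bigr => w' _.
by rewrite mulr_sumr; apply: eq_bigr => w _; rewrite mulrCA.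
Qed.

Lemma wsum_involution W (s : T * T -> T * T) (F : T * T -> R) : involutive s ->
  (forall u, mu (s u).1 * mu (s u).2 = mu u.1 * mu u.2) ->
  (forall u, W u.1 -> W u.2 -> W (s u).1 && W (s u).2) ->
  wsum mu W (fun w => wsum mu W (fun w' => F (s (w, w')))) =
  wsum mu W (fun w => wsum mu W (fun w' => F (w, w'))).
Proof.
move=> sK mu_s W_s.
have pairE H : wsum mu W (fun w => wsum mu W (fun w' => H (w, w'))) =
    \sum_(u | W u.1 && W u.2) mu u.1 * mu u.2 * H u.
  rewrite [RHS](eq_bigr (fun u => mu u.1 * mu u.2 * H (u.1, u.2))) => [|[]//].
  rewrite -(pair_big W W (fun w w' => mu w * mu w' * H (w, w'))) /=.
  by apply: eq_bigr => w _; rewrite mulr_sumr; apply: eq_bigr => w' _; rewrite mulrA.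
rewrite (pairE (F \o s)) pairE (reindex_inj (inv_inj sK)).
apply: eq_big => [u|u _]; last by rewrite /= sK mu_s.
by apply/idP/idP => /andP[/W_s/[apply]]; rewrite ?sK.
Qed.

Hypothesis mu_ge0 : forall w, 0 <= mu w.

Lemma ler_wsum W F G : (forall w, W w -> F w <= G w) -> wsum mu W F <= wsum mu W G.
Proof. by move=> FG; apply: ler_sum => w Ww; rewrite ler_wpM2l ?FG. Qed.

Lemma wsum_ge0 W F : (forall w, W w -> 0 <= F w) -> 0 <= wsum mu W F.
Proof. by move=> F_ge0; apply: sumr_ge0 => w Ww; rewrite mulr_ge0 ?F_ge0. Qed.

End weighted_sums.

Lemma exists_le_wsum (R : realDomainType) (T : finType) (mu : T -> R) (W : pred T)
    (F : T -> R) (c : R) (w0 : T) : (forall w, 0 < mu w) -> W w0 ->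
  wsum mu W F <= c * wsum mu W (fun=> 1) -> exists2 w, W w & F w <= c.
Proof.
move=> mu_gt0 Ww0; rewrite -wsum_cst => avg.
have [/existsP[w /andP[Ww Fc]]|/existsPn none] := boolP [exists w, W w && (F w <= c)].
  by exists w.
suff : wsum mu W (fun=> c) < wsum mu W F by rewrite ltNge avg.
apply: ltr_sum => [|w Ww]; first by apply/hasP; exists w0; rewrite ?mem_index_enum.
by rewrite ltr_pM2l// ltNge; have := none w; rewrite Ww.
Qed.

(** * Honest runs of a signature scheme *)

Definition meet_outside (K s t : seq query) : bool :=
  has [pred x | (x \in s) && (x \notin K)] t.

Section honest_runs.
Variables (R : realType) (M : Type) (S : scheme R M) (I : finType) (msg : I -> M).
Implicit Types (O : oracle) (c : outcome (gen_coins S)) (i : I) (K : seq query).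

Definition keys O c := run O (gen c).
Definition honest_sig O c i := run O (sign (keys O c).1 (msg i)).
Definition gen_sign_trace O c i : seq query :=
  trace O (gen c) ++ trace O (sign (keys O c).1 (msg i)).
Definition ver_trace O c i : seq query :=
  trace O (ver (keys O c).2 (msg i) (honest_sig O c i)).
Definition honest_trace O c : seq query :=
  flatten [seq gen_sign_trace O c i ++ ver_trace O c i | i <- enum I].

Lemma honest_traceP O c x :
  reflect (exists i, (x \in gen_sign_trace O c i) || (x \in ver_trace O c i))
    (x \in honest_trace O c).
Proof.
apply: (iffP flatten_mapP) => [[i _]|[i xi]]; first by rewrite mem_cat; exists i.
by exists i; rewrite ?mem_enum// mem_cat.
Qed.

Lemma gen_sign_trace_sub O c i : {subset gen_sign_trace O c i <= honest_trace O c}.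
Proof. by move=> x xi; apply/honest_traceP; exists i; rewrite xi. Qed.

Lemma ver_trace_sub O c i : {subset ver_trace O c i <= honest_trace O c}.
Proof. by move=> x xi; apply/honest_traceP; exists i; rewrite xi orbT. Qed.

Lemma honest_trace_bounded (G : finType) (coin : G -> outcome (gen_coins S)) :
  exists L, forall O g, {subset honest_trace O (coin g) <= below L}.
Proof.
pose honest (gi : G * I) := oalg_bind (gen (coin gi.1)) (fun kp =>
  oalg_bind (sign kp.1 (msg gi.2)) (fun s => ver kp.2 (msg gi.2) s)).
have /choice[f honest_below] := fun gi => trace_bounded (honest gi).
exists (\max_gi f gi) => O g x /honest_traceP[i xi].
rewrite inE; apply: leq_trans (leq_bigmax (g, i)).
apply: (honest_below (g, i) O).
by rewrite /honest !trace_bind !mem_cat orbA -mem_cat.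
Qed.

Lemma agree_gen_sign O O' c i : agree (gen_sign_trace O c i) O O' ->
  [/\ keys O' c = keys O c, honest_sig O' c i = honest_sig O c i &
      gen_sign_trace O' c i = gen_sign_trace O c i].
Proof.
move=> OO'.
have [|run_gen trace_gen] := agree_run (O := O) (O' := O') (p := gen c).
  by apply: sub_in1 OO' => x xt; rewrite mem_cat xt.
have [|run_sign trace_sign] :=
    agree_run (O := O) (O' := O') (p := sign (keys O c).1 (msg i)).
  by apply: sub_in1 OO' => x xt; rewrite mem_cat xt orbT.
have keysE : keys O' c = keys O c by [].
by rewrite /honest_sig /gen_sign_trace keysE trace_gen run_sign trace_sign.
Qed.

Lemma agree_honest O O' c : agree (honest_trace O c) O O' -> forall i,
  [/\ keys O' c = keys O c, honest_sig O' c i = honest_sig O c i,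
      gen_sign_trace O' c i = gen_sign_trace O c i & ver_trace O' c i = ver_trace O c i].
Proof.
move=> OO' i.
have [keysE sigE signE] := agree_gen_sign (sub_in1 (gen_sign_trace_sub (i := i)) OO').
split=> //; rewrite /ver_trace keysE sigE.
by have [_ ->] := agree_run (sub_in1 (ver_trace_sub (i := i)) OO').
Qed.

(* With the answers to [K] known, a signature on [msg i] allows no forgery: the
   verification of each other message depends on hidden queries of the signer. *)
Definition shielded K O c i : bool :=
  [forall j, (j != i) ==> meet_outside K (gen_sign_trace O c i) (ver_trace O c j)].

Definition self_shielded O c i : bool := shielded (ver_trace O c i) O c i.

Lemma agree_shielded K O O' c i : agree (honest_trace O c) O O' ->
  shielded K O' c i = shielded K O c i.
Proof.
move=> /agree_honest OO'; apply: eq_forallb => j.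
by have [_ _ _ ->] := OO' j; have [_ _ -> _] := OO' i.
Qed.

Lemma shielded_sub K K' O c i : {subset K' <= K} ->
  shielded K O c i -> shielded K' O c i.
Proof.
move=> K'K /forallP shielded_i; apply/forallP => j; apply/implyP => ji.
have /implyP/(_ ji)/hasP[x xj /andP[xi xK]] := shielded_i j.
by apply/hasP; exists x => //; rewrite inE xi (contra (K'K x)).
Qed.

Variable q : nat.
Hypothesis total : total_queries_le S q.

Lemma size_gen_sign_ver_trace O c i : 0 < Defs.pmf c ->
  (size (gen_sign_trace O c i) + size (ver_trace O c i) <= q)%N.
Proof.
move=> pmf_gt0; have := total O pmf_gt0 (msg i).
rewrite /gen_sign_trace /ver_trace /honest_sig /keys.
by case: (run O (gen c)) => sk vk /=; rewrite !nqueries_trace size_cat.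
Qed.

Lemma size_honest_trace O c : 0 < Defs.pmf c ->
  (size (honest_trace O c) <= q * #|I|)%N.
Proof.
move=> pmf_gt0; rewrite size_flatten /shape -map_comp sumnE big_map big_enum /=.
rewrite mulnC -sum_nat_const; apply: leq_sum => i _ /=.
by rewrite size_cat size_gen_sign_ver_trace.
Qed.

(* The pairs (Gen and Sign(i) without Ver(i), Ver(i)) are cross-intersecting. *)
Lemma card_self_shielded O c : 0 < Defs.pmf c ->
  (#|self_shielded O c| <= 'C(q, q %/ 2))%N.
Proof.
move=> pmf_gt0; pose T := seq_sub (honest_trace O c).
pose A i := finset (fun t : T =>
  (ssval t \in gen_sign_trace O c i) && (ssval t \notin ver_trace O c i)).
pose B i := finset (fun t : T => ssval t \in ver_trace O c i).
have card_le_size (s : seq query) (D : {set T}) :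
    (forall t, t \in D -> ssval t \in s) -> (#|D| <= size s)%N.
  move=> D_sub; rewrite cardE -(size_map val); apply: uniq_leq_size.
    by rewrite map_inj_uniq ?enum_uniq//; exact: val_inj.
  by move=> x /mapP[t]; rewrite mem_enum => /D_sub ? ->.
apply: (bollobas_card (A := A) (B := B)) => [|i _].
  split=> [i _|i j /forallP/(_ j)/implyP + _ ij].
    by apply/pred0P => t /=; rewrite !finset.in_set -andbA andNb andbF.
  rewrite eq_sym => /(_ ij)/hasP[x xj /andP[xi xvi]].
  apply/pred0Pn; exists (SeqSub (gen_sign_trace_sub xi)).
  by rewrite /= !finset.in_set /= xi xvi xj.
apply: leq_trans (size_gen_sign_ver_trace O i pmf_gt0).
by apply: leq_add; apply: card_le_size => t; rewrite finset.in_set// => /andP[].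
Qed.

Hypothesis complete : perfectly_complete S.

Lemma honest_accepts O c i : 0 < Defs.pmf c ->
  run O (ver (keys O c).2 (msg i) (honest_sig O c i)) = true.
Proof.
move=> pmf_gt0; have := complete O pmf_gt0 (msg i); rewrite /honest_sig /keys.
by case: (run O (gen c)).
Qed.

End honest_runs.

(** * The attack on finitely many worlds *)

Section attack.
Variables (R : realType) (M : Type) (S : scheme R M) (q : nat).
Hypotheses (complete : perfectly_complete S) (total : total_queries_le S q).
Variables (I : finType) (msg : I -> M).
Hypothesis msg_inj : injective msg.
Variables (G : finType) (coin : G -> outcome (gen_coins S)).
Hypothesis coin_gt0 : forall g, 0 < Defs.pmf (coin g).
Variable L : nat.
Hypothesis honest_below :
  forall O g, {subset honest_trace msg O (coin g) <= below L}.
Variable alpha : I.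

Definition world : finType := (finite_oracle L * G)%type.
Implicit Types (w : world) (u : world * world) (K : seq query) (O : oracle).

Local Notation forger := (oalg (M * signature S)).

Definition weight w : R := Defs.pmf (coin w.2) / #|finite_oracle L|%:R.

Lemma weight_gt0 w : 0 < weight w.
Proof. by rewrite divr_gt0// ltr0n card_finite_oracle_gt0. Qed.

Lemma weight_ge0 w : 0 <= weight w.
Proof. exact/ltW/weight_gt0. Qed.

Lemma wsum_weight1 : wsum weight xpredT (fun=> 1) = \sum_g Defs.pmf (coin g).
Proof.
rewrite /wsum -(pair_big xpredT xpredT (fun a g => weight (a, g) * 1)) exchange_big.
apply: eq_bigr => g _; rewrite /weight /= mulr1 sumr_const -[LHS]mulr_natr.
by rewrite mulfVK// pnatr_eq0 -lt0n card_finite_oracle_gt0.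
Qed.

Definition signing w : seq query := gen_sign_trace msg (extend w.1) (coin w.2) alpha.
Definition verifying w : seq query := ver_trace msg (extend w.1) (coin w.2) alpha.
Definition relevant w : seq query := honest_trace msg (extend w.1) (coin w.2).
Definition shielded_in K w : bool := shielded msg K (extend w.1) (coin w.2) alpha.
Definition view w : {classic vkey S * signature S} :=
  ((keys (extend w.1) (coin w.2)).2, honest_sig msg (extend w.1) (coin w.2) alpha).

Lemma signing_agree w w' : w'.2 = w.2 -> agree (signing w) (extend w.1) (extend w'.1) ->
  view w' = view w /\ signing w' = signing w.
Proof. by rewrite /view /signing => -> /agree_gen_sign[-> -> ->]. Qed.

Definition indist K w w' : bool :=
  (view w == view w') &&
  all (fun x => answer (extend w.1) x == answer (extend w'.1) x) K.

Lemma indistP K w w' :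
  reflect (view w = view w' /\ agree K (extend w.1) (extend w'.1)) (indist K w w').
Proof.
apply: (iffP andP) => [[/eqP same_view /allP agreeK]|[-> agreeK]].
  by split=> // x /agreeK/eqP.
by split; last by apply/allP => x /agreeK ->.
Qed.

Lemma indistxx K w : indist K w w.
Proof. exact/indistP. Qed.

Lemma indist_sym K : symmetric (indist K).
Proof.
by move=> w w'; apply/indistP/indistP => -[-> agreeK]; split=> // x /agreeK ->.
Qed.

Lemma indist_trans K : transitive (indist K).
Proof.
move=> w2 w1 w3 /indistP[same_view12 agree12] /indistP[same_view23 agree23].
by apply/indistP; split=> [|x xK]; [rewrite same_view12|rewrite agree12 ?agree23].
Qed.

Lemma indist_ltrans K : left_transitive (indist K).
Proof. exact: sym_left_transitive (@indist_sym K) (@indist_trans K). Qed.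

Lemma indist_cons K x w w' :
  indist (x :: K) w w' =
  indist K w w' && (answer (extend w'.1) x == answer (extend w.1) x).
Proof. by rewrite /indist /= andbCA andbC [_ == answer (extend w.1) _]eq_sym. Qed.

Lemma indist_patch K w w' : w'.2 = w.2 ->
  agree (signing w) (extend w.1) (extend w'.1) -> agree K (extend w.1) (extend w'.1) ->
  indist K w w'.
Proof.
move=> same_coins /(signing_agree same_coins)[same_view _] agreeK.
by apply/indistP; rewrite same_view.
Qed.

(* The imagined world [w'] on the queries of Gen and Sign(alpha), the real world
   [w] elsewhere. *)
Definition hybrid w' w : world := (mix (signing w') w'.1 w.1, w'.2).

(* The two worlds exchange their oracles, except on the queries of Gen and
   Sign(alpha) in either of them. *)
Definition swap u : world * world :=
  let T := [predU signing u.1 & signing u.2] in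
  ((mix T u.1.1 u.2.1, u.1.2), (mix T u.2.1 u.1.1, u.2.2)).

Lemma swap_agree u :
  agree (signing u.1) (extend u.1.1) (extend (swap u).1.1) /\
  agree (signing u.2) (extend u.2.1) (extend (swap u).2.1).
Proof. by split=> x xs; rewrite answer_mix inE xs ?orbT. Qed.

Lemma signing_swap u :
  signing (swap u).1 = signing u.1 /\ signing (swap u).2 = signing u.2.
Proof.
have [agree1 agree2] := swap_agree u.
by split; [apply: (signing_agree _ agree1).2|apply: (signing_agree _ agree2).2].
Qed.

Lemma swapK : involutive swap.
Proof.
move=> u; have [signing1 signing2] := signing_swap u.
case: u signing1 signing2 => -[a g] [b h] signing1 signing2.
rewrite {1}/swap signing1 signing2 /=.
by congr ((_, _), (_, _)); apply: extend_inj => x; rewrite !answer_mix; case: (x \in _).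
Qed.

Lemma indist_swap K u : indist K u.1 u.2 ->
  indist K u.1 (swap u).1 && indist K u.2 (swap u).2.
Proof.
move=> /indistP[_ agreeK]; have [agree1 agree2] := swap_agree u.
by apply/andP; split; apply: indist_patch => // x xK;
  rewrite answer_mix; case: ifP => // _; rewrite (agreeK x xK).
Qed.

Lemma shielded_hybrid K w w' : indist K w w' ->
  shielded_in K (hybrid w' w) ->
  shielded_in K (swap (w, w')).2 ||
  meet_outside K (signing (swap (w, w')).1) (relevant (swap (w, w')).2).
Proof.
move=> /indistP[_ agreeK] shielded_w.
have [|] := boolP (meet_outside _ _ _); first by rewrite orbT.
rewrite (signing_swap (w, w')).1 orbF /shielded_in => /hasPn apart.
rewrite -(agree_shielded _ _ (O' := extend (hybrid w' w).1))// => x xQ.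
rewrite !answer_mix inE /=; have [|_] := boolP (x \in signing w'); first by rewrite orbT.
rewrite orbF; case: ifP => // xw; apply/esym/agreeK.
by have := apart _ xQ; rewrite inE xw /= negbK.
Qed.

(* Stated for every oracle extending the finite one, so that winning is an event
   decided by the answers to strings of length below [L]. *)
Definition wins (p : forger) w : Prop :=
  forall O, agree (below L) (extend w.1) O ->
    (run O p).1 <> msg alpha /\
    run O (ver (view w).1 (run O p).1 (run O p).2) = true.

Definition winning (forge : vkey S -> signature S -> forger) w : bool :=
  `[< wins (forge (view w).1 (view w).2) w >].

Definition sign_and_verify (kp : skey S * vkey S) i : oalg (signature S * seq query) :=
  oalg_bind (sign kp.1 (msg i)) (fun s =>
  oalg_bind (logged (ver kp.2 (msg i) s)) (fun r => Return (s, r.2))).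

Definition hybrid_forger K w' : forger :=
  oalg_bind
    (patched (signing w') (extend w'.1)
       (ofind (sign_and_verify (keys (extend w'.1) (coin w'.2)))
          (fun i r => (i != alpha) && ~~ meet_outside K (signing w') r.2) (enum I)))
    (fun r => Return (if r is Some (i, (s, _)) then (msg i, s)
                      else (msg alpha, (view w').2))).

Lemma run_sign_and_verify O c i :
  run O (sign_and_verify (keys O c) i) = (honest_sig msg O c i, ver_trace msg O c i).
Proof. by rewrite /sign_and_verify !run_bind run_logged. Qed.

Lemma nqueries_sign_and_verify O c i : 0 < Defs.pmf c ->
  (nqueries O (sign_and_verify (keys O c) i) <= q)%N.
Proof.
move=> pmf_gt0; apply: leq_trans (size_gen_sign_ver_trace msg total O i pmf_gt0).
rewrite nqueries_trace /sign_and_verify !trace_bind trace_logged /= cats0.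
by rewrite !size_cat -addnA leq_addl.
Qed.

Lemma signing_patch O w' (P := patch_oracle (signing w') (extend w'.1) O) :
  keys P (coin w'.2) = keys (extend w'.1) (coin w'.2) /\
  gen_sign_trace msg P (coin w'.2) alpha = signing w'.
Proof.
by have [-> _ ->] := agree_gen_sign (@agree_patch _ (signing w') (extend w'.1) O).
Qed.

Lemma nqueries_hybrid_forger K O w' : (nqueries O (hybrid_forger K w') <= q * #|I|)%N.
Proof.
rewrite nqueries_trace trace_bind /= cats0 -nqueries_trace.
apply: leq_trans (nqueries_patched _ _ _ _) _; rewrite -(signing_patch O w').1 cardE.
by apply: nqueries_ofind => i; exact: nqueries_sign_and_verify.
Qed.

Lemma run_hybrid_forger K O w' (P := patch_oracle (signing w') (extend w'.1) O) :
  ~~ shielded msg K P (coin w'.2) alpha ->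
  exists i, [/\ i != alpha,
    ~~ meet_outside K (signing w') (ver_trace msg P (coin w'.2) i) &
    run O (hybrid_forger K w') = (msg i, honest_sig msg P (coin w'.2) i)].
Proof.
have [keysP signP] := signing_patch O w'.
move=> /forallPn[j]; rewrite negb_imply signP => /andP[ja apart].
rewrite /hybrid_forger run_bind run_patched -keysP.
have [|i [/andP[ia iK] ->]] := run_ofind (O := P)
  (p := sign_and_verify (keys P (coin w'.2))) (s := enum I)
  (ok := fun i r => (i != alpha) && ~~ meet_outside K (signing w') r.2).
  by apply/hasP; exists j; rewrite ?mem_enum// run_sign_and_verify ja.
by exists i; move: iK; rewrite !run_sign_and_verify.
Qed.

Lemma hybrid_forger_wins K w w' : indist K w' w -> ~~ shielded_in K (hybrid w' w) ->
  wins (hybrid_forger K w') w.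
Proof.
move=> /indistP[same_view agreeK] unshielded O wO.
pose P := patch_oracle (signing w') (extend w'.1) O; pose c := coin w'.2.
have hybridP : agree (honest_trace msg (extend (hybrid w' w).1) c)
    (extend (hybrid w' w).1) P.
  move=> x /honest_below xL; rewrite answer_mix answer_patch; case: ifP => // _.
  exact: wO.
have [|i [ia apart ->]] := @run_hybrid_forger K O w'.
  by rewrite (agree_shielded _ _ hybridP).
split=> [/msg_inj/eqP|]; first by rewrite (negbTE ia).
rewrite -same_view /= -(signing_patch O w').1.
rewrite -(honest_accepts msg complete P i (coin_gt0 w'.2)).
apply: (agree_run _).1 => x xi; rewrite answer_patch; case: ifP => // xs.
rewrite -wO; last exact: honest_below (ver_trace_sub xi).
rewrite agreeK//; move/hasPn/(_ _ xi): apart.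
by rewrite inE xs negbK.
Qed.

Variable eps : R.
Hypotheses (eps_gt0 : 0 < eps) (eps_le1 : eps <= 1).

Local Notation indist_sum K w0 := (wsum weight (indist K w0)).

Definition mass K w0 : R := indist_sum K w0 (fun=> 1).

Lemma mass_gt0 K w0 : 0 < mass K w0.
Proof.
rewrite /mass /wsum (bigD1 w0) ?indistxx//= mulr1 ltr_pwDl ?weight_gt0//.
by apply: sumr_ge0 => w _; rewrite mulr1 ltW ?weight_gt0.
Qed.

Definition heavy K w0 x : bool := (x \notin K) &&
  (eps * mass K w0 <= indist_sum K w0 (fun w => (x \in relevant w)%:R)).

Lemma heavy_below K w0 x : heavy K w0 x -> x \in below L.
Proof.
move=> /andP[_]; apply: contraTT => xL; rewrite -ltNge.
rewrite [X in X < _](_ : _ = 0) ?mulr_gt0 ?mass_gt0//.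
apply: big1 => w _; rewrite (negbTE (contra (@honest_below _ _ x) xL)).
by rewrite mulr0.
Qed.

Section no_heavy_query.
Variables (K : seq query) (w0 : world).
Hypothesis light : forall x, ~~ heavy K w0 x.

Lemma light_relevant x : x \notin K ->
  indist_sum K w0 (fun w => (x \in relevant w)%:R) <= eps * mass K w0.
Proof. by move=> xK; have := light x; rewrite /heavy xK /= -ltNge => /ltW. Qed.

(* The first query of Ver(alpha) outside [K] is the same in all indistinguishable
   worlds, hence heavy. *)
Lemma verifying_known w : indist K w0 w -> {subset verifying w <= K}.
Proof.
move=> w0w.
have [//|[x xK first_x]] := trace_first_outside K (extend w.1)
  (ver (view w).1 (msg alpha) (view w).2).
have := light x; rewrite /heavy xK /= => /negP[].
apply: (@le_trans _ _ (mass K w0)); first by rewrite ler_piMl// ltW ?mass_gt0.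
rewrite /mass; apply: (ler_wsum weight_ge0) => w' w0w'; rewrite ler1n lt0b.
have /indistP[same_view agreeK] : indist K w w' by rewrite -(indist_ltrans w0w).
apply: (@ver_trace_sub _ _ _ _ _ _ _ alpha).
by have := first_x _ agreeK; rewrite same_view.
Qed.

Lemma wsum_meet_outside_le s :
  indist_sum K w0 (fun w => (meet_outside K s (relevant w))%:R) <=
  (size s)%:R * eps * mass K w0.
Proof.
have union w : (meet_outside K s (relevant w))%:R <=
    \sum_(x <- s) ((x \notin K) && (x \in relevant w))%:R :> R.
  rewrite -natr_sum ler_nat.
  have [/hasP[x xw /andP[xs xK]]|//] := boolP (meet_outside _ _ _).
  by rewrite (big_rem x xs) /= xK xw.
apply: le_trans (ler_wsum weight_ge0 (fun w _ => union w)) _.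
rewrite wsum_sum -sum1_size natr_sum -mulrA mulr_suml.
apply: ler_sum => x _; rewrite mul1r; have [xK|xK] := boolP (x \in K) => /=.
  by rewrite /wsum big1 ?mulr_ge0 ?ltW ?mass_gt0// => w _; rewrite mulr0.
exact: light_relevant.
Qed.

(* The swap turns a hybrid world into an honest one, up to the unlikely event that
   some relevant query is hidden in the signature of an independent world. *)
Lemma wsum_shielded_hybrid_le :
  indist_sum K w0 (fun w =>
    indist_sum K w0 (fun w' => (shielded_in K (hybrid w' w))%:R)) <=
  (indist_sum K w0 (fun w => (shielded_in K w)%:R) + q%:R * eps * mass K w0)
  * mass K w0.
Proof.
pose F u : R := (shielded_in K u.2)%:R +
  (meet_outside K (signing u.1) (relevant u.2))%:R.
have W_swap u : indist K w0 u.1 -> indist K w0 u.2 ->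
    indist K w0 (swap u).1 && indist K w0 (swap u).2.
  move=> w0_u1 w0_u2; rewrite (indist_ltrans w0_u1) [X in _ && X](indist_ltrans w0_u1).
  rewrite (indist_ltrans w0_u1) in w0_u2.
  by have /andP[-> /=] := indist_swap w0_u2; exact: indist_trans.
apply: (@le_trans _ _ (indist_sum K w0 (fun w =>
    indist_sum K w0 (fun w' => F (swap (w, w')))))).
  apply: (ler_wsum weight_ge0) => w w0w; apply: (ler_wsum weight_ge0) => w' w0w'.
  rewrite (indist_ltrans w0w) in w0w'; have := shielded_hybrid w0w'.
  rewrite /F -natrD ler_nat.
  case: (shielded_in _ (hybrid _ _)) => // /(_ isT).
  by case: (shielded_in _ _) => //=; case: (meet_outside _ _ _).
rewrite wsum_involution//; last exact: swapK.
rewrite -wsum_cst; apply: (ler_wsum weight_ge0) => w w0w; rewrite wsumD lerD2l /=.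
apply: le_trans (wsum_meet_outside_le _) _.
rewrite ler_pM2r ?mass_gt0// ler_pM2r// ler_nat.
exact: leq_trans (leq_addr _ _) (size_gen_sign_ver_trace _ total _ _ (coin_gt0 _)).
Qed.

Lemma exists_imagined_world : exists2 w', indist K w0 w' &
  indist_sum K w0 (fun w => (shielded_in K (hybrid w' w))%:R) <=
  indist_sum K w0 (fun w => (shielded_in K w)%:R) + q%:R * eps * mass K w0.
Proof.
apply: (exists_le_wsum weight_gt0 (indistxx K w0)).
by rewrite wsum_exchange wsum_shielded_hybrid_le.
Qed.

End no_heavy_query.

(* Failing is excused when the message is self-shielded, and beyond that with
   probability [q * eps]. *)
Definition regret (p : forger) w : R :=
  (~~ `[< wins p w >])%:R -
  (self_shielded msg (extend w.1) (coin w.2) alpha)%:R - q%:R * eps.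

Lemma regret_le1 p w : regret p w <= 1.
Proof.
have q_eps_ge0 : 0 <= q%:R * eps by rewrite mulr_ge0// ltW.
by rewrite /regret; case: (~~ _); case: self_shielded => /=; lra.
Qed.

Lemma wsum_regret_le_mass K w0 p : indist_sum K w0 (regret p) <= mass K w0.
Proof. by apply: (ler_wsum weight_ge0) => w _; exact: regret_le1. Qed.

Lemma exists_forger_no_heavy K w0 : (forall x, ~~ heavy K w0 x) ->
  exists p : forger, (forall O, nqueries O p <= q * #|I|)%N /\
    indist_sum K w0 (regret p) <= 0.
Proof.
move=> light; have [w' w0w' shielded_w'] := exists_imagined_world light.
exists (hybrid_forger K w'); split=> [ O |]; first exact: nqueries_hybrid_forger.
rewrite !wsumB wsum_cst -addrA -opprD subr_le0.
apply: le_trans (le_trans _ shielded_w') _; last first.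
  rewrite lerD2r; apply: (ler_wsum weight_ge0) => w w0w; rewrite ler_nat.
  have [shielded_w|//] := boolP (shielded_in _ _).
  rewrite /self_shielded (shielded_sub _ shielded_w)//.
  exact: verifying_known light _ w0w.
apply: (ler_wsum weight_ge0) => w w0w; rewrite ler_nat.
have [|unshielded] := boolP (shielded_in _ _); first by rewrite leq_b1.
rewrite asboolT//; apply: hybrid_forger_wins unshielded.
by rewrite -(indist_ltrans w0w').
Qed.

Definition fresh K w : nat := count [predC K] (undup (relevant w)).

Lemma fresh_cons K x w :
  x \notin K -> ((x \in relevant w) + fresh (x :: K) w)%N = fresh K w.
Proof.
move=> xK; rewrite -mem_undup -(count_uniq_mem _ (undup_uniq _)) -count_predUI.
rewrite addnC (eq_count (a2 := pred0)) ?count_pred0 => [|y]; last first.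
  by rewrite /= in_cons; case: eqP.
by apply: eq_count => y; rewrite /= in_cons; case: eqP => // ->.
Qed.

Lemma fresh_le K w : (fresh K w <= q * #|I|)%N.
Proof.
apply: leq_trans (count_size _ _) (leq_trans (size_undup _) _).
exact: size_honest_trace.
Qed.

Definition potential K w0 : R := indist_sum K w0 (fun w => (fresh K w)%:R).

Lemma potential_ge0 K w0 : 0 <= potential K w0.
Proof. by apply: (wsum_ge0 weight_ge0) => w _. Qed.

Lemma potential_heavy K w0 x : heavy K w0 x ->
  eps * mass K w0 + indist_sum K w0 (fun w => (fresh (x :: K) w)%:R) <=
  potential K w0.
Proof.
move=> /andP[xK heavy_x]; apply: le_trans (lerD heavy_x (lexx _)) _.
rewrite -wsumD; apply: (ler_wsum weight_ge0) => w _.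
by rewrite -natrD (fresh_cons _ xK).
Qed.

Lemma regret_query x (f : (tag x).-tuple bool -> forger) w :
  x \in below L ->
  regret (Query (tagged x) f) w <= regret (f (answer (extend w.1) x)) w.
Proof.
move=> xL; rewrite /regret !lerD2r ler_nat.
case: asboolP => [//|lose]; rewrite asboolF// => win.
by apply: lose => O wO /=; rewrite -/(answer O x) -(wO _ xL); exact: win.
Qed.

Lemma exists_next_forger K w0 x c (f : world -> forger) :
  x \in below L -> 0 <= c ->
  (forall w1, c * indist_sum (x :: K) w1 (regret (f w1)) <=
    potential (x :: K) w1) ->
  exists2 next, forall y, exists w1, next y = f w1 &
    c * indist_sum K w0 (regret (Query (tagged x) next)) <=
    indist_sum K w0 (fun w => (fresh (x :: K) w)%:R).
Proof.
move=> xL c_ge0 regret_f; pose ans w := answer (extend w.1) x.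
pose rep y := odflt w0 [pick w | indist K w0 w && (ans w == y)].
exists (f \o rep) => [y|]; first by exists (rep y).
rewrite mulr_wsumr; apply: (ler_sum_fibers (f := ans)) => w1 w0w1.
have [w0r /eqP ans_r] : indist K w0 (rep (ans w1)) /\ ans (rep (ans w1)) == ans w1.
  by apply/andP; rewrite /rep; case: pickP => [//|/(_ w1)]; rewrite w0w1 /= eqxx.
set r := rep (ans w1) in w0r ans_r.
have fiberE w : indist K w0 w && (ans w == ans w1) = indist (x :: K) r w.
  by rewrite indist_cons -(indist_ltrans w0r) -ans_r.
under eq_bigl do rewrite fiberE; under [leRHS]eq_bigl do rewrite fiberE.
apply: le_trans (regret_f r); rewrite mulr_wsumr.
apply: (ler_wsum weight_ge0) => w; rewrite -fiberE => /andP[_ /eqP ans_w].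
by rewrite ler_wpM2l// /r -ans_w; exact: (regret_query (f \o rep)).
Qed.

(* Asking a heavy query lowers the potential by at least [eps] times the mass; once
   there is none, the hybrid forger has no regret. *)
Lemma exists_learning_forger (B : nat) K w0 : exists p : forger,
  (forall O, nqueries O p <= B + q * #|I|)%N /\
  B.+1%:R * eps * indist_sum K w0 (regret p) <= potential K w0.
Proof.
have eps_ge0 := ltW eps_gt0.
have forge_now n K' w0' : (forall x, ~~ heavy K' w0' x) ->
    exists p : forger, (forall O, nqueries O p <= n + q * #|I|)%N /\
      n.+1%:R * eps * indist_sum K' w0' (regret p) <= potential K' w0'.
  move=> /exists_forger_no_heavy[p [queries_p regret_p]]; exists p; split=> [ O |].
    exact: leq_trans (queries_p O) (leq_addl _ _).
  by apply: le_trans (potential_ge0 _ _); rewrite mulr_ge0_le0 ?mulr_ge0.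
elim: B K w0 => [|B IH] K w0;
  (have [[x heavy_x]|/forallNP light] := pselect (exists x, heavy K w0 x);
    last by apply: forge_now => x; apply/negP).
  exists (Return (msg alpha, (view w0).2)); split=> //.
  apply: le_trans (potential_heavy heavy_x); rewrite mul1r -[leLHS]addr0.
  by rewrite lerD ?ler_wpM2l ?wsum_regret_le_mass// (wsum_ge0 weight_ge0).
have /choice[f /all_and2[queries_f regret_f]] := IH (x :: K).
have [|||next next_f regret_next] := @exists_next_forger K w0 x (B.+1%:R * eps) f.
- exact: heavy_below heavy_x.
- by rewrite mulr_ge0.
- exact: regret_f.
exists (Query (tagged x) next); split=> [ O |].
  by have [w1 /= ->] := next_f (O _ (tagged x)); rewrite addSn ltnS queries_f.
apply: le_trans (potential_heavy heavy_x).
rewrite -[B.+2%:R]natr1 mulrDl mul1r mulrDl addrC lerD//.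
by rewrite ler_wpM2l// wsum_regret_le_mass.
Qed.

Lemma exists_forger_of_view (B : nat) :
  exists forge : vkey S -> signature S -> forger,
    (forall O vk s, nqueries O (forge vk s) <= B + q * #|I|)%N /\
    B.+1%:R * eps *
      wsum weight xpredT (fun w => regret (forge (view w).1 (view w).2) w)
    <= q%:R * #|I|%:R * wsum weight xpredT (fun=> 1).
Proof.
have /choice[f /all_and2[queries_f regret_f]] := exists_learning_forger B [::].
pose rep v := [pick w | view w == v].
exists (fun vk s => if rep (vk, s) is Some w then f w else Return (msg alpha, s)).
split=> [ O vk s|]; first by case: (rep _).
rewrite !mulr_wsumr; apply: (ler_sum_fibers (f := view)) => w1 _.
have [w0 repE /eqP view_w0] : exists2 w0, rep (view w1) = Some w0 & view w0 == view w1.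
  by rewrite /rep; case: pickP => [w0 view_w0|/(_ w1)]; [exists w0|rewrite eqxx].
have fiberE w : (view w == view w1) = indist [::] w0 w.
  by rewrite /indist andbT view_w0 eq_sym.
under eq_bigl do rewrite /= fiberE; under [leRHS]eq_bigl do rewrite /= fiberE.
apply: (@le_trans _ _ (potential [::] w0)); last first.
  apply: (ler_wsum weight_ge0) => w _; rewrite mulr1 -natrM ler_nat; exact: fresh_le.
apply: le_trans (regret_f w0); rewrite mulr_wsumr.
apply: (ler_wsum weight_ge0) => w; rewrite -fiberE => /eqP view_w.
by rewrite -surjective_pairing view_w repE.
Qed.

End attack.

(** * Random oracles *)

Lemma card_finite_oracle (L : nat) :
  #|finite_oracle L| = (\prod_(l < L) #|{ffun l.-tuple bool -> l.-tuple bool}|)%N.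
Proof. by rewrite card_dep_ffun foldrE big_map big_enum. Qed.

Section random_oracle_theory.
Local Open Scope classical_set_scope.
Variables (R : realType) (d : measure_display) (Omega : measurableType d).
Variables (P : probability Omega R) (O : Omega -> oracle).
Hypothesis ro : random_oracle P O.
Variable L : nat.
Implicit Types (a : finite_oracle L) (D : pred (finite_oracle L)).

Let cylinder a := [set w | truncate L (O w) = a].

Let random_oracle_cylinder a : measurable (cylinder a) /\
  P (cylinder a) = (#|finite_oracle L|%:R^-1)%:E.
Proof.
have -> : cylinder a = [set w | forall l, (l < L)%N -> @O w l =1 @extend _ a l].
  apply/seteqP; split=> [w <- l lL x|w aE].
    exact: esym (extend_truncate (O w) (x := Tagged (fun l => l.-tuple bool) x) lL).
  by rewrite /cylinder /= -[a]extendK; apply: truncate_agree => -[l x] lL; exact: aE.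
have [mE ->] := ro L (extend a); split=> //.
by rewrite card_finite_oracle natr_prod prodfV.
Qed.

Let truncate_preimage D :
  [set w | D (truncate L (O w))] = \bigcup_(a in [set` D]) cylinder a.
Proof.
by apply/seteqP; split=> w /=; [exists (truncate L (O w))|case=> a /= Da ->].
Qed.

Lemma measurable_truncate D : measurable [set w | D (truncate L (O w))].
Proof.
rewrite truncate_preimage; apply: fin_bigcup_measurable => [|a _].
  exact: finite_finset.
exact: (random_oracle_cylinder a).1.
Qed.

Lemma prob_truncate D :
  P [set w | D (truncate L (O w))] = (#|D|%:R / #|finite_oracle L|%:R)%:E.
Proof.
rewrite truncate_preimage measure_fin_bigcup.
- rewrite -(@bigfs _ _ _ _ (enum D)) ?enum_uniq//; last first.
    by move=> a Da; rewrite mem_enum [a \in D]Da.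
  rewrite (eq_bigr (fun=> (#|finite_oracle L|%:R^-1)%:E)) => [|a _]; last first.
    exact: (random_oracle_cylinder a).2.
  rewrite big_enum_cond sumEFin sumr_const -[X in X%:E = _]mulr_natl; congr (_%:R * _)%:E.
  by apply: eq_card => a; rewrite -!topredE /= andbb.
- exact: finite_finset.
- by move=> a b _ _ [w [/= <- <-]].
- by move=> a _; exact: (random_oracle_cylinder a).1.
Qed.

End random_oracle_theory.

Section measurability.
Local Open Scope classical_set_scope.
Variables (R : realType) (d : measure_display) (Omega : measurableType d).
Variables (P : probability Omega R) (O : Omega -> oracle).
Hypothesis ro : random_oracle P O.

Lemma measurable_run (A : Type) (p : oalg A) (D : A -> Prop) :
  measurable [set w | D (run (O w) p)].
Proof.
have [L p_below] := trace_bounded p.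
have truncE w : run (O w) p = run (extend (truncate L (O w))) p.
  apply: (agree_run _).1 => x xp; exact: extend_truncate (p_below _ _ xp).
rewrite (_ : [set w | _] = [set w | `[< D (run (extend (truncate L (O w))) p) >]]).
  exact: (measurable_truncate ro (fun a => `[< D (run (extend a) p) >])).
by apply/seteqP; split=> w /=; rewrite truncE => /asboolP.
Qed.

Lemma measurable_breaks (M : Type) (S : scheme R M) (A : adversary S) g a :
  measurable [set w | breaks (A := A) (O w) g a].
Proof.
pose game := oalg_bind (gen g) (fun kp =>
  oalg_bind (sign kp.1 (adv_msg a)) (fun s =>
  oalg_bind (adv_forge (a := A) a kp.2 s) (fun r =>
  oalg_bind (ver kp.2 r.1 r.2) (fun b => Return (r.1 <> adv_msg a /\ b = true))))).
rewrite (_ : [set w | _] = [set w | id (run (O w) game)]).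
  exact: (measurable_run game id).
apply/seteqP; split=> w /=; rewrite /breaks /game !run_bind;
  by case: (run (O w) (gen g)) => sk vk /=; case: (run (O w) (adv_forge _ _ _)).
Qed.

End measurability.

(** * The adversary *)

Lemma esum_unit (R : realType) (x : \bar R) :
  (0 <= x -> \esum_(c in [set: unit]) x = x)%E.
Proof.
move=> x_ge0; rewrite (_ : setT = [set tt])%classic ?esum_set1//.
by apply/seteqP; split=> // -[].
Qed.

Definition no_coins (R : realType) : coins R :=
  @Coins R unit (fun=> 1) (fun=> ler01) (esum_unit lee01).

Definition deterministic_adversary (R : realType) (M : Type) (S : scheme R M) (m : M)
    (forge : vkey S -> signature S -> oalg (M * signature S)) : adversary S :=
  @Adversary R M S (no_coins R) (fun=> m) (fun=> forge).

Lemma success_prob_ge0 (R : realType) (M : Type) (S : scheme R M) (A : adversary S)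
    (d : measure_display) (Omega : measurableType d) (P : probability Omega R)
    (O : Omega -> oracle) : (0 <= success_prob A P O)%E.
Proof.
by apply: esum_ge0 => c _; rewrite mule_ge0// lee_fin mulr_ge0 ?Defs.pmf_ge0.
Qed.

Lemma coins_finite_approx (R : realType) (c : coins R) (eta : R) : 0 < eta ->
  exists (n : nat) (f : 'I_n -> outcome c), [/\ injective f,
    forall i, 0 < Defs.pmf (f i) & 1 - eta <= \sum_i Defs.pmf (f i) <= 1].
Proof.
move=> eta_gt0.
have /ereal_sup_gt[_ [X [finX _] <-] sumX] :
    ((1 - eta)%:E < \esum_(x in [set: outcome c]) (Defs.pmf x)%:E)%E.
  by rewrite pmf_sum1 lte_fin; lra.
pose s := [seq x : outcome c <- finmap.enum_fset (fset_set X) | 0 < Defs.pmf x].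
exists (size s), (tnth (in_tuple s)); split=> [|i|].
- by apply/tuple_uniqP; rewrite filter_uniq ?finmap.fset_uniq.
- by have := mem_tnth i (in_tuple s); rewrite mem_filter => /andP[].
have -> : \sum_i Defs.pmf (tnth (in_tuple s) i) =
    \sum_(x <- finmap.enum_fset (fset_set X)) Defs.pmf x.
  rewrite -(big_tnth _ _ s xpredT) big_filter [RHS](bigID (fun x => 0 < Defs.pmf x)) /=.
  rewrite [X in _ + X]big1 ?addr0// => x; rewrite -leNgt => pmf_le0.
  by apply/eqP; rewrite eq_le pmf_le0 Defs.pmf_ge0.
rewrite -!lee_fin -sumEFin -fsbig_finite// ltW//= -(pmf_sum1 c).
by apply: esum_ge; exists X.
Qed.

Section success_probability.
Variables (R : realType) (M : Type) (S : scheme R M) (I : finType) (msg : I -> M).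
Variables (G : finType) (coin : G -> outcome (gen_coins S)).
Hypothesis coin_inj : injective coin.
Variable L : nat.
Hypothesis honest_below :
  forall O g, {subset honest_trace msg O (coin g) <= below L}.
Variables (alpha : I) (forge : vkey S -> signature S -> oalg (M * signature S)).

Lemma winning_breaks O g : winning msg coin alpha forge (truncate L O, g) ->
  breaks (A := deterministic_adversary (msg alpha) forge) O (coin g) tt.
Proof.
move=> /asboolP/(_ O (extend_truncate O)); rewrite /view /=.
have [] := @agree_honest _ _ _ _ msg (extend (truncate L O)) O (coin g) _ alpha.
  by move=> x /honest_below; exact: extend_truncate.
rewrite /breaks /honest_sig => <- <- _ _; rewrite /keys /=.
by case: (run O (gen (coin g))) => sk vk /=; case: (run O (forge _ _)).
Qed.

Lemma success_prob_ge (d : measure_display) (Omega : measurableType d)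
    (P : probability Omega R) (O : Omega -> oracle) : random_oracle P O ->
  ((wsum (weight coin (L := L)) xpredT (fun w =>
      (winning msg coin alpha forge w)%:R))%:E <=
   success_prob (deterministic_adversary (msg alpha) forge) P O)%E.
Proof.
move=> ro; pose win := winning msg coin alpha forge (L := L).
pose r := [seq (coin g, tt) | g <- enum G].
have uniq_r : uniq r by rewrite map_inj_uniq ?enum_uniq// => g h [/coin_inj].
apply: esum_ge; exists [set` r]%classic; first by split=> //; exact: finite_seq.
rewrite -fsbig_seq// big_map big_enum /=.
apply: (@le_trans _ _ (\sum_g (Defs.pmf (coin g) *
    (#|[pred a | win (a, g)]|%:R / #|finite_oracle L|%:R))%:E)%E).
  rewrite sumEFin lee_fin /wsum.
  rewrite -(pair_big xpredT xpredT (fun a g => weight coin (a, g) * (win (a, g))%:R)) /=.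
  rewrite exchange_big ler_sum// => g _; rewrite -sum1_card natr_sum mulr_suml mulr_sumr.
  rewrite [leRHS]big_mkcond ler_sum// => a _ /=; rewrite inE.
  by case: (win _); rewrite ?mulr0// mulr1 mul1r.
apply: lee_sum => g _; rewrite mulr1 EFinM lee_wpmul2l ?lee_fin ?Defs.pmf_ge0//.
rewrite -(prob_truncate ro [pred a | win (a, g)]).
apply: le_measure; rewrite ?inE.
- exact: (measurable_truncate ro [pred a | win (a, g)]).
- exact: (measurable_breaks ro (A := deterministic_adversary (msg alpha) forge)
           (coin g) tt).
- by move=> w; exact: winning_breaks.
Qed.

End success_probability.

Lemma exists_seldom_self_shielded (R : realType) (M : Type) (S : scheme R M) (q : nat)
    (I : finType) (msg : I -> M) (G : finType) (coin : G -> outcome (gen_coins S))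
    (L : nat) (lambda : R) : total_queries_le S q ->
  (forall g, 0 < Defs.pmf (coin g)) -> (0 < #|I|)%N ->
  'C(q, q %/ 2)%:R <= lambda * #|I|%:R ->
  exists alpha, wsum (weight coin (L := L)) xpredT (fun w =>
      (self_shielded msg (extend w.1) (coin w.2) alpha)%:R) <=
    lambda * wsum (weight coin (L := L)) xpredT (fun=> 1).
Proof.
move=> total coin_gt0 /card_gt0P[i0 _] central_le.
pose shielded_mass i : R := wsum (weight coin (L := L)) xpredT (fun w =>
  (self_shielded msg (extend w.1) (coin w.2) i)%:R).
suff [alpha _ alpha_le] : exists2 i, xpredT i &
    shielded_mass i <= lambda * wsum (weight coin (L := L)) xpredT (fun=> 1).
  by exists alpha.
apply: (@exists_le_wsum R I (fun=> 1) xpredT _ _ i0) => //.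
have -> : @wsum R I (fun=> 1) xpredT (fun=> 1) = #|I|%:R.
  by rewrite /wsum mulr1 sumr_const.
rewrite mulrAC -wsum_cst {1}/wsum; under eq_bigr do rewrite mul1r.
rewrite -wsum_sum; apply: (ler_wsum (weight_ge0 (L := L) coin_gt0)) => w _.
apply: le_trans central_le; rewrite -natr_sum ler_nat.
apply: leq_trans (card_self_shielded msg total (extend w.1) (coin_gt0 w.2)).
rewrite -sum1_card [leqRHS]big_mkcond; apply: leq_sum => i _.
by rewrite -topredE /=; case: ifP.
Qed.

Section learning_parameters.
Variables (R : realType) (q k : nat) (delta : R).
Hypothesis delta_gt0 : 0 < delta.

(* [q.+1] rather than [q]: a scheme may ask no query at all. *)
Definition heavy_threshold : R := delta / (4 * q.+1%:R).

(* The factor 32 makes the right-hand side of [learning_budget_ge] at least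
   [2 * q ^ 2 * k / q.+1]. *)
Definition learning_budget : nat := Num.truncn (32 * q%:R ^+ 2 * k%:R / delta ^+ 2).

Lemma heavy_threshold_gt0 : 0 < heavy_threshold.
Proof. by rewrite divr_gt0// mulr_gt0 ?ltr0n. Qed.

Lemma mulr_heavy_threshold_le : q%:R * heavy_threshold <= delta / 4.
Proof.
rewrite /heavy_threshold invfM [delta * _]mulrA mulrCA.
rewrite ler_piMr ?divr_ge0 ?(ltW delta_gt0)//.
by rewrite ler_pdivrMr ?ltr0n// mul1r ler_nat.
Qed.

Lemma learning_budget_ge :
  q%:R * k%:R <= learning_budget.+1%:R * heavy_threshold * (delta / 4).
Proof.
rewrite -mulrA; set x := heavy_threshold * _.
have x_gt0 : 0 < x by rewrite mulr_gt0 ?heavy_threshold_gt0 ?divr_gt0.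
apply: (@le_trans _ _ (32 * q%:R ^+ 2 * k%:R / delta ^+ 2 * x)); last first.
  by rewrite ler_pM2r// ltW// truncnS_gt.
have -> : 32 * q%:R ^+ 2 * k%:R / delta ^+ 2 * x = 2 * q%:R ^+ 2 * k%:R / q.+1%:R.
  rewrite /x /heavy_threshold; field.
  by rewrite (gt_eqF delta_gt0) nat1r pnatr_eq0.
rewrite ler_pdivlMr ?ltr0n// mulrAC ler_wpM2r// -natrX -!natrM ler_nat; nia.
Qed.

Lemma learning_budget_le : delta <= 1 ->
  (learning_budget + q * k)%:R <= 33 * q%:R ^+ 2 * k%:R / delta ^+ 2 :> R.
Proof.
move=> delta_le1; have delta_sqr_gt0 : 0 < delta ^+ 2 by rewrite exprn_gt0.
have budget : learning_budget%:R <= 32 * q%:R ^+ 2 * k%:R / delta ^+ 2 :> R.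
  by rewrite truncn_le !mulr_ge0 ?invr_ge0 ?(ltW delta_sqr_gt0).
have signing : (q * k)%:R <= q%:R ^+ 2 * k%:R / delta ^+ 2 :> R.
  rewrite ler_pdivlMr// natrM -natrX.
  apply: (@le_trans _ _ (q%:R * k%:R * 1)).
    by rewrite ler_wpM2l ?mulr_ge0// expr_le1 ?(ltW delta_gt0).
  by rewrite mulr1 ler_wpM2r// ler_nat; case: (q) => // j; rewrite leq_pmulr.
by rewrite natrD; lra.
Qed.

End learning_parameters.

Lemma exists_low_regret_forger (R : realType) (M : Type) (S : scheme R M) (q : nat)
    (I : finType) (msg : I -> M) (G : finType) (coin : G -> outcome (gen_coins S))
    (L : nat) (alpha : I) (delta : R) :
  perfectly_complete S -> total_queries_le S q -> injective msg ->
  (forall g, 0 < Defs.pmf (coin g)) ->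
  (forall O g, {subset honest_trace msg O (coin g) <= below L}) ->
  0 < delta -> delta <= 1 ->
  exists forge : vkey S -> signature S -> oalg (M * signature S),
    (forall O vk s, (nqueries O (forge vk s))%:R <=
      33 * q%:R ^+ 2 * #|I|%:R / delta ^+ 2) /\
    wsum (weight coin (L := L)) xpredT (fun w =>
      regret q msg coin alpha (heavy_threshold q delta)
        (forge (view msg coin alpha w).1 (view msg coin alpha w).2) w) <=
    delta / 4 * wsum (weight coin (L := L)) xpredT (fun=> 1).
Proof.
move=> complete total msg_inj coin_gt0 honest_below delta_gt0 delta_le1.
have eps_gt0 := heavy_threshold_gt0 q delta_gt0.
have eps_le1 : heavy_threshold q delta <= 1.
  rewrite ler_pdivrMr ?mul1r ?mulr_gt0 ?ltr0n//.
  by rewrite (le_trans delta_le1)// -natrM ler1n.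
have [forge [forge_queries regret_forge]] :=
  exists_forger_of_view complete total msg_inj coin_gt0
    honest_below alpha eps_gt0 eps_le1 (learning_budget q #|I| delta).
exists forge; split=> [ O vk s|].
  apply: le_trans (learning_budget_le q #|I| delta_gt0 delta_le1).
  by rewrite ler_nat.
rewrite -(@ler_pM2l _ ((learning_budget q #|I| delta).+1%:R * heavy_threshold q delta)).
  apply: le_trans regret_forge _; rewrite mulrA ler_wpM2r ?learning_budget_ge//.
  by apply: (wsum_ge0 (weight_ge0 (L := L) coin_gt0)) => w _.
by rewrite mulr_gt0.
Qed.

Lemma exists_breaking_adversary (R : realType) (M : Type) (S : scheme R M) (q : nat)
    (I : finType) (msg : I -> M) (lambda delta : R) :
  perfectly_complete S -> total_queries_le S q -> injective msg -> (0 < #|I|)%N ->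
  'C(q, q %/ 2)%:R <= lambda * #|I|%:R -> 0 < lambda -> 0 < delta -> delta <= 1 ->
  exists A : adversary S,
    adv_queries_le A (33 * q%:R ^+ 2 * #|I|%:R / delta ^+ 2) /\
    forall (d : measure_display) (Omega : measurableType d)
           (P : probability Omega R) (O : Omega -> oracle), random_oracle P O ->
      ((1 - (lambda + delta))%:E <= success_prob A P O)%E.
Proof.
move=> complete total msg_inj I_gt0 central_le lambda_gt0 delta_gt0 delta_le1.
have [|N [coin [coin_inj coin_gt0 /andP[m_ge m_le]]]] :=
  coins_finite_approx (gen_coins S) (eta := delta / 4); first by rewrite divr_gt0.
have [L honest_below] := honest_trace_bounded msg coin.
have [alpha seldom] := exists_seldom_self_shielded msg L total coin_gt0 I_gt0 central_le.
have [forge [forge_queries low_regret]] :=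
  exists_low_regret_forger alpha complete total msg_inj
    coin_gt0 honest_below delta_gt0 delta_le1.
exists (deterministic_adversary (msg alpha) forge); split=> [ O a|d Omega P O ro].
  exact: forge_queries.
apply: le_trans (success_prob_ge coin_inj honest_below alpha forge ro).
have total_weight := wsum_weight1 coin L; rewrite -total_weight in m_ge m_le.
rewrite lee_fin; move: seldom low_regret.
rewrite !wsumB /winning wsum_negb (wsum_cst _ _ (q%:R * _)).
move: m_ge m_le; move: (wsum _ _ (fun=> 1)) => m m_ge m_le.
have m_ge0 : 0 <= m by lra.
have threshold := ler_wpM2r m_ge0 (mulr_heavy_threshold_le q delta_gt0).
have : (lambda + delta / 2) * m <= lambda + delta / 2 by rewrite ler_piMr//; lra.
lra.
Qed.

Lemma card_ge_messages (R : realType) (M : Type) (r : R) : 0 < r -> card_ge M r ->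
  exists (k : nat) (msg : 'I_k -> M), injective msg /\ r <= k%:R < r + 1.
Proof.
move=> r_gt0 [n r_le_n In_le_M]; have r_le_k : exists k : nat, r <= k%:R by exists n.
case: (ex_minnP r_le_k) => k {}r_le_k k_min.
have k_gt0 : (0 < k)%N by rewrite -(ltr0n R); apply: lt_le_trans r_le_k.
have /card_leP[f] : (`I_k #<= [set: M])%card.
  by apply: card_le_trans In_le_M; rewrite card_le_II k_min.
have in_Ik (i : 'I_k) : nat_of_ord i \in (`I_k)%classic by rewrite inE /=.
exists k, (fun i => val (f (SigSub (in_Ik i)))); split.
  move=> i j /val_inj fij; apply: val_inj.
  by have [] := @inj _ _ _ f _ _ (mem_set I) (mem_set I) fij.
rewrite r_le_k /= -(prednK k_gt0) -natr1 ltrD2r ltNge.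
by apply/negP => /k_min; rewrite leqNgt prednK ?leqnn.
Qed.

Lemma exists_breaking_adversary_card_ge (R : realType) (M : Type) (S : scheme R M)
    (q : nat) (lambda delta : R) :
  perfectly_complete S -> total_queries_le S q -> 0 < lambda -> 0 < delta ->
  card_ge M ('C(q, q %/ 2)%:R / lambda) ->
  exists A : adversary S,
    adv_queries_le A (66 * (q%:R ^+ 2 * 'C(q, q %/ 2)%:R / (lambda * delta ^+ 2))) /\
    forall (d : measure_display) (Omega : measurableType d)
           (P : probability Omega R) (O : Omega -> oracle), random_oracle P O ->
      ((1 - (lambda + delta))%:E <= success_prob A P O)%E.
Proof.
move=> complete total lambda_gt0 delta_gt0 M_large.
set b := 'C(q, q %/ 2)%:R in M_large *.
have b_ge1 : 1 <= b by rewrite ler1n central_bin_gt0.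
have b_lambda_gt0 : 0 < b / lambda by rewrite divr_gt0// (lt_le_trans ltr01).
have [k [msg [msg_inj /andP[k_ge k_lt]]]] := card_ge_messages b_lambda_gt0 M_large.
have k_gt0 : (0 < k)%N by rewrite -(ltr0n R); apply: lt_le_trans k_ge.
have [vacuous|small] := leP 1 (lambda + delta).
  exists (deterministic_adversary (msg (Ordinal k_gt0))
    (fun _ s => Return (msg (Ordinal k_gt0), s))); split=> [ O a vk s|d Omega P O _] /=.
    by rewrite !mulr_ge0 ?invr_ge0 ?mulr_ge0 ?exprn_ge0 ?(ltW lambda_gt0)
      ?(ltW delta_gt0).
  by apply: le_trans (success_prob_ge0 _ _ _); rewrite lee_fin; lra.
have b_lambda_ge1 : 1 <= b / lambda by rewrite ler_pdivlMr//; lra.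
have [|||||A [A_queries A_success]] := @exists_breaking_adversary R M S q 'I_k msg
  lambda delta complete total msg_inj;
  rewrite ?card_ord ?[lambda * k%:R]mulrC -?ler_pdivrMr//; first lra.
exists A; split=> // O a vk s; apply: le_trans (A_queries O a vk s) _.
have -> : 66 * (q%:R ^+ 2 * b / (lambda * delta ^+ 2)) =
    33 * q%:R ^+ 2 * (2 * (b / lambda)) / delta ^+ 2.
  by field; rewrite (gt_eqF delta_gt0) (gt_eqF lambda_gt0).
rewrite card_ord ler_wpM2r ?invr_ge0 ?exprn_ge0 ?(ltW delta_gt0)//.
by rewrite ler_wpM2l ?mulr_ge0 ?exprn_ge0//; lra.
Qed.

Theorem theorem4p1 (R : realType) :
  exists C C' : R, 0 < C /\ 0 < C' /\
  forall (M : Type) (S : scheme R M) (q : nat) (lambda delta : R),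
    perfectly_complete S -> total_queries_le S q ->
    0 < lambda -> 0 < delta ->
    card_ge M ('C(q, q %/ 2)%:R / lambda) ->
    let bound1 := q%:R ^+ 2 * 'C(q, q %/ 2)%:R / (lambda * delta ^+ 2) in
    let bound2 := q%:R `^ (3 / 2) * 2 ^+ q / (lambda * delta ^+ 2) in
    bound1 <= C' * bound2 /\
    exists A : adversary S,
      adv_queries_le A (C * bound1) /\
      forall (d : measure_display) (Omega : measurableType d)
             (P : probability Omega R) (O : Omega -> oracle),
        random_oracle P O ->
        ((1 - (lambda + delta))%:E <= success_prob A P O)%E.
Proof.
exists 66, 1; split=> //; split=> // M S q lambda delta.
move=> complete total lambda_gt0 delta_gt0 M_large bound1 bound2.
split; last exact: exists_breaking_adversary_card_ge.
have denominator_gt0 : 0 < lambda * delta ^+ 2 by rewrite mulr_gt0 ?exprn_gt0.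
by rewrite mul1r ler_pM2r ?invr_gt0// sqr_central_bin_le_powR.
Qed.
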